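(* Let $n\ge1$. The groupification functor $\mathbf{g}:mon\to gr$ induces an isomorphism of preadditive categories $P_n\mathbf{g}:P_n^{\mathcal{A}s}mon\to P_n^{\mathbb{G}r}gr$ such that $P_n\mathbf{g}\circ\underline{p}_n^{\mathcal{A}s}=\underline{p}_n^{\mathbb{G}r}\circ\mathbf{g}$.
   Context: $mon$ (resp. $gr$) is the category with objects the sets $\underline m=\{1,\dots,m\}$, $m\ge0$, and morphisms $\underline k\to\underline l$ the homomorphisms between the free monoids (resp. free groups) on $\underline k$ and $\underline l$. $\mathbf{g}$ denotes the groupification functor, left adjoint to the forgetful functor from groups to monoids; it takes the free monoid on $\underline m$ to the free group on $\underline m$ and so gives a functor $\mathbf{g}:mon\to gr$, the identity on objects. For a monoid or group $N$ with unit $1$, $I(N)=\ker(\mathbb{Z}[N]\to\mathbb{Z},\ x\mapsto1)$ is the augmentation ideal. For a monoid $N$ put $P_n^{\mathcal{A}s}(N)=I(N)/I^{n+1}_{\mathcal{A}s}(N)$, where $I^{n+1}_{\mathcal{A}s}(N)=\sum_{m\ge n+1}\sum_{\theta}\bar\theta(I(N)^{\otimes m})$, $\theta$ running over the operations $(x_1,\dots,x_m)\mapsto x_{\pi(1)}\cdots x_{\pi(m)}$, $\pi\in\mathfrak{S}_m$, and $\bar\theta:\mathbb{Z}[N]^{\otimes m}\to\mathbb{Z}[N]$ being the linear extension of $\theta$ (thus $I^{n+1}_{\mathcal{A}s}(N)$ is the $(n+1)$-st power $I(N)^{n+1}$). For a group $G$ put $P_n^{\mathbb{G}r}(G)=I(G)/I^{n+1}_{\mathbb{G}r}(G)$,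 where $I^{n+1}_{\mathbb{G}r}(G)=\sum_{m\ge n+1}\sum_w\bar w(I(G)^{\otimes m})$, $w$ running over all elements of the free group on $x_1,\dots,x_m$, and $\bar w:\mathbb{Z}[G]^{\otimes m}\to\mathbb{Z}[G]$ being the linear map with $g_1\otimes\cdots\otimes g_m\mapsto w(g_1,\dots,g_m)$. In both cases $p_n(x)$ denotes the class of $x-1$. The set $mon(\underline k,\underline l)$ is a monoid and $gr(\underline k,\underline l)$ is a group under pointwise multiplication on generators, i.e. via evaluation on generators they are identified with the $k$-th cartesian power of the free monoid, resp. free group, on $\underline l$. $P_n^{\mathcal{A}s}mon$ (resp. $P_n^{\mathbb{G}r}gr$) is the preadditive category with objects $\underline m$, $m\ge0$, morphism groups $\mathrm{Hom}(\underline k,\underline l)=P_n^{\mathcal{A}s}(mon(\underline k,\underline l))$ (resp. $P_n^{\mathbb{G}r}(gr(\underline k,\underline l))$) and bilinear composition satisfying $p_n(g)\circ p_n(f)=p_n(g\circ f)$. The functors $\underline{p}_n^{\mathcal{A}s}:mon\to P_n^{\mathcal{A}s}mon$ and $\underline{p}_n^{\mathbb{G}r}:gr\to P_n^{\mathbb{G}r}gr$ are the identity on objects and send a morphism $f$ to $p_n(f)$. *)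

(* Defs.v *)
From HB Require Import structures.
From mathcomp Require Import all_boot all_fingroup all_algebra.
From mathcomp Require Import boolp.
From mathcomp Require Import freeg.

Set Implicit Arguments.
Unset Strict Implicit.
Unset Printing Implicit Defensive.

Import GRing.Theory.

Local Open Scope ring_scope.

Notation monoid_hom := UMagmaMorphism.type.

Lemma monoid_homP (M N : monoidType) (f g : monoid_hom M N) : f =1 g -> f = g.
Proof.
case: f g => [f [[fM] [f1]]] [g [[gM] [g1]]] /= /funext fg.
case: _ / fg gM g1 => gM g1.
by rewrite (Prop_irrelevance fM gM) (Prop_irrelevance f1 g1).
Qed.

Section FreeMonoid.
Variable T : choiceType.

Definition free_monoid := seq T.
HB.instance Definition _ := Choice.on free_monoid.
HB.instance Definition _ :=
  isMonoid.Build free_monoid (@catA T) (@cat0s T) (@cats0 T).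

Definition fm_gen (i : T) : free_monoid := [:: i].

Definition fm_lift (M : monoidType) (f : T -> M) (w : free_monoid) : M :=
  (\prod_(i <- w) f i)%g.

Lemma fm_lift_morph (M : monoidType) (f : T -> M) :
  monoid.monoid_morphism (fm_lift f).
Proof. by split=> [|u v]; rewrite /fm_lift ?big_nil // big_cat. Qed.

HB.instance Definition _ (M : monoidType) (f : T -> M) :=
  isUMagmaMorphism.Build free_monoid M (fm_lift f) (fm_lift_morph f).

Lemma fm_liftE (M : monoidType) (f : T -> M) i : fm_lift f (fm_gen i) = f i.
Proof. by rewrite /fm_lift big_seq1. Qed.

Lemma fm_lift_nil (M : monoidType) (f : T -> M) : fm_lift f [::] = 1%g.
Proof. by rewrite /fm_lift big_nil. Qed.

Lemma fm_lift_cons (M : monoidType) (f : T -> M) i w :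
  fm_lift f (i :: w) = (f i * fm_lift f w)%g.
Proof. by rewrite /fm_lift big_cons. Qed.

Lemma fm_homE (M : monoidType) (h : monoid_hom free_monoid M) :
  h =1 fm_lift (h \o fm_gen).
Proof.
elim=> [|i w IH]; first by rewrite fm_lift_nil; exact: gmulf1.
by rewrite fm_lift_cons -IH; exact: (gmulfM (fm_gen i) w).
Qed.

End FreeMonoid.

(* A letter (i, b) stands for x_i if b = false and for x_i^-1 if b = true. *)
Section FreeGroup.
Variable T : choiceType.
Local Notation letter := (T * bool)%type.

Definition linv (a : letter) : letter := (a.1, ~~ a.2).

Arguments linv : simpl never.

Definition reduced_word (w : seq letter) := sorted (fun a b => b != linv a) w.

Record free_group := FreeGroup {
  fg_word :> seq letter;
  fg_wordP : reduced_word fg_word }.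
HB.instance Definition _ := [isSub for fg_word].
HB.instance Definition _ := [Choice of free_group by <:].

(* The reduced form of a :: w for w reduced. *)
Definition lcons (a : letter) (w : seq letter) : seq letter :=
  if w is b :: w' then if b == linv a then w' else a :: w else [:: a].

Lemma linvK : involutive linv.
Proof. by case=> i b; rewrite /linv negbK. Qed.

Lemma lcons_reduced a w : reduced_word w -> reduced_word (lcons a w).
Proof.
case: w => [|b w] //= bw; case: ifPn => [_|ba] /=; first exact: path_sorted bw.
by rewrite ba.
Qed.

Lemma lconsK a w : reduced_word w -> lcons (linv a) (lcons a w) = w.
Proof.
case: w => [|b w] /=; first by rewrite linvK eqxx.
move=> bw; case: eqP => [bE|_] /=; last by rewrite linvK eqxx.
case: w bw => [|c w] /=; first by rewrite bE.
by rewrite bE linvK => /andP[/negPf-> _].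
Qed.

Lemma lconsVK a w : reduced_word w -> lcons a (lcons (linv a) w) = w.
Proof. by move=> ?; rewrite -{1}[a]linvK lconsK. Qed.

(* Left multiplication by the word u on reduced words. *)
Definition lact (u w : seq letter) := foldr lcons w u.

Lemma lact_reduced u w : reduced_word w -> reduced_word (lact u w).
Proof. by move=> ?; elim: u => //= a u; exact: lcons_reduced. Qed.

Lemma lact_lcons a u w : reduced_word u -> reduced_word w ->
  lact (lcons a u) w = lcons a (lact u w).
Proof.
case: u => [|b u] //= _ rw; case: eqP => //= ->.
by rewrite lconsVK //; exact: lact_reduced.
Qed.

Lemma lact_lact u v w : reduced_word v -> reduced_word w ->
  lact (lact u v) w = lact u (lact v w).
Proof.
move=> rv rw; elim: u => //= a u IH.
by rewrite lact_lcons ?IH //; exact: lact_reduced.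
Qed.

Lemma lact_nil u : reduced_word u -> lact u [::] = u.
Proof.
elim: u => //= a u IH au; rewrite IH; last exact: path_sorted au.
by case: u au {IH} => //= b u /andP[/negPf-> _].
Qed.

Lemma linv_reduced u : reduced_word u -> reduced_word (rev (map linv u)).
Proof.
rewrite /reduced_word rev_sorted sorted_map; apply: sub_sorted => a b /=.
rewrite /relpre /= linvK => ab.
by apply: contra ab => /eqP ->.
Qed.

Definition fg_mul (u v : free_group) : free_group :=
  FreeGroup (lact_reduced u (fg_wordP v)).
Definition fg_one : free_group := @FreeGroup [::] isT.
Definition fg_inv (u : free_group) : free_group :=
  FreeGroup (linv_reduced (fg_wordP u)).

Lemma fg_mulA : associative fg_mul.
Proof.
by move=> u v w; apply/val_inj; rewrite /= lact_lact //; exact: fg_wordP.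
Qed.
Lemma fg_mul1 : left_id fg_one fg_mul.
Proof. by move=> u; exact/val_inj. Qed.
Lemma fg_mulr1 : right_id fg_one fg_mul.
Proof. by move=> u; apply/val_inj/lact_nil/fg_wordP. Qed.

Lemma lactV u w : reduced_word w -> lact (rev (map linv u)) (lact u w) = w.
Proof.
move=> rw; elim: u => //= a u IH.
rewrite rev_cons -cats1 /lact foldr_cat /= lconsK //; exact: lact_reduced.
Qed.

Lemma fg_mulV : left_inverse fg_one fg_inv fg_mul.
Proof.
move=> u; apply/val_inj => /=.
by rewrite -[X in lact _ X](lact_nil (fg_wordP u)) lactV.
Qed.
Lemma fg_invK : involutive fg_inv.
Proof.
move=> u; apply/val_inj => /=; rewrite map_rev revK mapK //; exact: linvK.
Qed.
Lemma fg_mulrV : right_inverse fg_one fg_inv fg_mul.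
Proof. by move=> u; rewrite -{1}[u]fg_invK fg_mulV. Qed.

HB.instance Definition _ :=
  isGroup.Build free_group fg_mulA fg_mul1 fg_mulr1 fg_mulV fg_mulrV.

Definition fg_gen (i : T) : free_group := @FreeGroup [:: (i, false)] isT.

Definition letter_val (G : groupType) (f : T -> G) (a : letter) : G :=
  if a.2 then (f a.1)^-1%g else f a.1.

Definition fg_lift (G : groupType) (f : T -> G) (w : free_group) : G :=
  (\prod_(a <- fg_word w) letter_val f a)%g.

Lemma letter_valV (G : groupType) (f : T -> G) a :
  letter_val f (linv a) = (letter_val f a)^-1%g.
Proof. by case: a => i [] /=; rewrite /letter_val /= ?invgK. Qed.

Lemma fg_lift_morph (G : groupType) (f : T -> G) :
  monoid.monoid_morphism (fg_lift f).
Proof.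
split=> [|u v]; first by rewrite /fg_lift big_nil.
case: u => u ru; rewrite /fg_lift /=; elim: u {ru} => [|a u IH] /=.
  by rewrite big_nil mul1g.
rewrite big_cons -mulgA -IH; case: (lact u v) => [|b w] /=.
  by rewrite big_seq1 big_nil mulg1.
case: eqP => [->|_]; last by rewrite big_cons.
by rewrite big_cons letter_valV mulVKg.
Qed.

HB.instance Definition _ (G : groupType) (f : T -> G) :=
  isUMagmaMorphism.Build free_group G (fg_lift f) (fg_lift_morph f).

Lemma fg_liftE (G : groupType) (f : T -> G) i : fg_lift f (fg_gen i) = f i.
Proof. by rewrite /fg_lift big_seq1. Qed.

Lemma fg_word_letter a (u : free_group) :
  fg_word (letter_val fg_gen a * u)%g = lcons a (fg_word u).
Proof. by case: a => i []. Qed.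

Lemma lcons_cons a w : reduced_word (a :: w) -> lcons a w = a :: w.
Proof. by case: w => //= b w /andP[/negPf-> _]. Qed.

Lemma fg_word_prod (w : free_group) :
  w = (\prod_(a <- fg_word w) letter_val fg_gen a)%g.
Proof.
case: w => w rw; apply/val_inj => /=; elim: w rw => [|a w IH] rw.
  by rewrite big_nil.
rewrite big_cons fg_word_letter -IH ?lcons_cons //; exact: path_sorted rw.
Qed.

Lemma fg_homE (G : groupType) (h : monoid_hom free_group G) :
  h =1 fg_lift (h \o fg_gen).
Proof.
move=> w; rewrite {1}[w]fg_word_prod gmulf_prod; apply: eq_bigr => -[i b] _.
by rewrite /letter_val /=; case: b; rewrite ?gmulfV.
Qed.

End FreeGroup.

Record category := Category {
  obj :> Type;
  hom : obj -> obj -> Type;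
  idm : forall a, hom a a;
  comp : forall a b c, hom b c -> hom a b -> hom a c;
  comp1m : forall a b (f : hom a b), comp (idm b) f = f;
  compm1 : forall a b (f : hom a b), comp f (idm a) = f;
  compmA : forall a b c d (h : hom c d) (g : hom b c) (f : hom a b),
    comp h (comp g f) = comp (comp h g) f }.

Record functor (A B : category) := Functor {
  fobj :> A -> B;
  fmap : forall a b, hom a b -> hom (fobj a) (fobj b);
  fmap1 : forall a, fmap (idm a) = idm (fobj a);
  fmapM : forall a b c (g : hom b c) (f : hom a b),
    fmap (comp g f) = comp (fmap g) (fmap f) }.

Definition id_functor (A : category) : functor A A :=
  @Functor A A id (fun a b f => f) (fun _ => erefl) (fun _ _ _ _ _ => erefl).

Section CompFunctor.
Variables (A B C : category) (G : functor B C) (F : functor A B).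

Lemma comp_functor1 a : fmap G (fmap F (idm a)) = idm (G (F a)).
Proof. by rewrite !fmap1. Qed.

Lemma comp_functorM a b c (g : hom b c) (f : hom a b) :
  fmap G (fmap F (comp g f)) = comp (fmap G (fmap F g)) (fmap G (fmap F f)).
Proof. by rewrite !fmapM. Qed.

Definition comp_functor : functor A C :=
  @Functor A C (fun a => G (F a)) (fun a b f => fmap G (fmap F f))
    comp_functor1 comp_functorM.
End CompFunctor.

Record preadditive := Preadditive {
  pobj : Type;
  phom : pobj -> pobj -> zmodType;
  pidm : forall a, phom a a;
  pcomp : forall a b c, phom b c -> phom a b -> phom a c;
  pcomp1m : forall a b (f : phom a b), pcomp (pidm b) f = f;
  pcompm1 : forall a b (f : phom a b), pcomp f (pidm a) = f;
  pcompmA : forall a b c d (h : phom c d) (g : phom b c) (f : phom a b),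
    pcomp h (pcomp g f) = pcomp (pcomp h g) f;
  pcompDl : forall a b c (g g' : phom b c) (f : phom a b),
    pcomp (g + g') f = pcomp g f + pcomp g' f;
  pcompDr : forall a b c (g : phom b c) (f f' : phom a b),
    pcomp g (f + f') = pcomp g f + pcomp g f' }.

Coercion underlying (A : preadditive) : category :=
  @Category (pobj A) (@phom A) (@pidm A) (@pcomp A)
    (@pcomp1m A) (@pcompm1 A) (@pcompmA A).

Record additive_functor (A B : preadditive) := AdditiveFunctor {
  afunctor :> functor A B;
  afmapD : forall (a b : pobj A) (f g : phom a b),
    fmap afunctor (f + g : phom a b) =
    (fmap afunctor f : phom _ _) + (fmap afunctor g : phom _ _) :> phom _ _ }.

Definition is_preadditive_iso (A B : preadditive) (F : additive_functor A B) :=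
  exists G : additive_functor B A,
    comp_functor G F = id_functor A /\ comp_functor F G = id_functor B.

Section Mon.

Definition mon_hom k l := monoid_hom (free_monoid 'I_k) (free_monoid 'I_l).

Definition mon_ext k l (f : 'I_k -> free_monoid 'I_l) : mon_hom k l := fm_lift f.

Definition mon_ev k l (h : mon_hom k l) : {ffun 'I_k -> free_monoid 'I_l} :=
  [ffun i => h (fm_gen i)].

Lemma mon_extE k l (f : 'I_k -> free_monoid 'I_l) i :
  mon_ext f (fm_gen i) = f i.
Proof. exact: fm_liftE. Qed.

Lemma mon_homP k l (f g : mon_hom k l) :
  (forall i, f (fm_gen i) = g (fm_gen i)) -> f = g.
Proof.
move=> fg; apply: monoid_homP => w; rewrite [LHS]fm_homE [RHS]fm_homE; congr (fm_lift _ w).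
exact/funext.
Qed.

Lemma mon_evK k l : cancel (@mon_ev k l) (fun f => mon_ext f).
Proof. by move=> h; apply: mon_homP => i; rewrite mon_extE ffunE. Qed.

Lemma mon_extK k l :
  cancel (fun f : {ffun 'I_k -> free_monoid 'I_l} => mon_ext f) (@mon_ev k l).
Proof. by move=> f; apply/ffunP => i; rewrite ffunE mon_extE. Qed.

HB.instance Definition _ k l :=
  Choice.copy (mon_hom k l) (can_type (@mon_evK k l)).

(* The monoid structure transported from the power (free_monoid 'I_l)^k along
   evaluation on generators. *)
Definition mon_mul k l (f g : mon_hom k l) : mon_hom k l :=
  mon_ext (fun i => f (fm_gen i) * g (fm_gen i))%g.
Definition mon_one k l : mon_hom k l := mon_ext (fun=> 1%g).

Lemma mon_mulA k l : associative (@mon_mul k l).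
Proof. by move=> f g h; apply: mon_homP => i; rewrite !mon_extE mulgA. Qed.
Lemma mon_mul1 k l : left_id (@mon_one k l) (@mon_mul k l).
Proof. by move=> f; apply: mon_homP => i; rewrite !mon_extE mul1g. Qed.
Lemma mon_mulr1 k l : right_id (@mon_one k l) (@mon_mul k l).
Proof. by move=> f; apply: mon_homP => i; rewrite !mon_extE mulg1. Qed.

HB.instance Definition _ k l := isMonoid.Build (mon_hom k l)
  (@mon_mulA k l) (@mon_mul1 k l) (@mon_mulr1 k l).

Definition mon_id k : mon_hom k k := idfun.
Definition mon_comp k l m (g : mon_hom l m) (f : mon_hom k l) : mon_hom k m :=
  g \o f.

Lemma mon_comp1m k l (f : mon_hom k l) : mon_comp (mon_id l) f = f.
Proof. exact: monoid_homP. Qed.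
Lemma mon_compm1 k l (f : mon_hom k l) : mon_comp f (mon_id k) = f.
Proof. exact: monoid_homP. Qed.
Lemma mon_compA j k l m (h : mon_hom l m) (g : mon_hom k l) (f : mon_hom j k) :
  mon_comp h (mon_comp g f) = mon_comp (mon_comp h g) f.
Proof. exact: monoid_homP. Qed.

Definition mon : category := @Category nat mon_hom mon_id mon_comp
  mon_comp1m mon_compm1 mon_compA.

End Mon.

Section Gr.

Definition gr_hom k l := monoid_hom (free_group 'I_k) (free_group 'I_l).

Definition gr_ext k l (f : 'I_k -> free_group 'I_l) : gr_hom k l := fg_lift f.

Definition gr_ev k l (h : gr_hom k l) : {ffun 'I_k -> free_group 'I_l} :=
  [ffun i => h (fg_gen i)].

Lemma gr_extE k l (f : 'I_k -> free_group 'I_l) i :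
  gr_ext f (fg_gen i) = f i.
Proof. exact: fg_liftE. Qed.

Lemma gr_homP k l (f g : gr_hom k l) :
  (forall i, f (fg_gen i) = g (fg_gen i)) -> f = g.
Proof.
move=> fg; apply: monoid_homP => w; rewrite [LHS]fg_homE [RHS]fg_homE; congr (fg_lift _ w).
exact/funext.
Qed.

Lemma gr_evK k l : cancel (@gr_ev k l) (fun f => gr_ext f).
Proof. by move=> h; apply: gr_homP => i; rewrite gr_extE ffunE. Qed.

Lemma gr_extK k l :
  cancel (fun f : {ffun 'I_k -> free_group 'I_l} => gr_ext f) (@gr_ev k l).
Proof. by move=> f; apply/ffunP => i; rewrite ffunE gr_extE. Qed.

HB.instance Definition _ k l :=
  Choice.copy (gr_hom k l) (can_type (@gr_evK k l)).

(* The group structure transported from the power (free_group 'I_l)^k along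
   evaluation on generators. *)
Definition gr_mul k l (f g : gr_hom k l) : gr_hom k l :=
  gr_ext (fun i => f (fg_gen i) * g (fg_gen i))%g.
Definition gr_one k l : gr_hom k l := gr_ext (fun=> 1%g).
Definition gr_inv k l (f : gr_hom k l) : gr_hom k l :=
  gr_ext (fun i => (f (fg_gen i))^-1)%g.

Lemma gr_mulA k l : associative (@gr_mul k l).
Proof. by move=> f g h; apply: gr_homP => i; rewrite !gr_extE mulgA. Qed.
Lemma gr_mul1 k l : left_id (@gr_one k l) (@gr_mul k l).
Proof. by move=> f; apply: gr_homP => i; rewrite !gr_extE mul1g. Qed.
Lemma gr_mulr1 k l : right_id (@gr_one k l) (@gr_mul k l).
Proof. by move=> f; apply: gr_homP => i; rewrite !gr_extE mulg1. Qed.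
Lemma gr_mulV k l : left_inverse (@gr_one k l) (@gr_inv k l) (@gr_mul k l).
Proof. by move=> f; apply: gr_homP => i; rewrite !gr_extE mulVg. Qed.
Lemma gr_mulrV k l : right_inverse (@gr_one k l) (@gr_inv k l) (@gr_mul k l).
Proof. by move=> f; apply: gr_homP => i; rewrite !gr_extE mulgV. Qed.

HB.instance Definition _ k l := isGroup.Build (gr_hom k l)
  (@gr_mulA k l) (@gr_mul1 k l) (@gr_mulr1 k l) (@gr_mulV k l) (@gr_mulrV k l).

Definition gr_id k : gr_hom k k := idfun.
Definition gr_comp k l m (g : gr_hom l m) (f : gr_hom k l) : gr_hom k m :=
  g \o f.

Lemma gr_comp1m k l (f : gr_hom k l) : gr_comp (gr_id l) f = f.
Proof. exact: monoid_homP. Qed.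
Lemma gr_compm1 k l (f : gr_hom k l) : gr_comp f (gr_id k) = f.
Proof. exact: monoid_homP. Qed.
Lemma gr_compA j k l m (h : gr_hom l m) (g : gr_hom k l) (f : gr_hom j k) :
  gr_comp h (gr_comp g f) = gr_comp (gr_comp h g) f.
Proof. exact: monoid_homP. Qed.

Definition gr : category := @Category nat gr_hom gr_id gr_comp
  gr_comp1m gr_compm1 gr_compA.

End Gr.

Section Groupification.

(* The unit of the adjunction: the monoid morphism from the free monoid to its
   groupification, x_i |-> x_i (see grp_unit_univ and grp_homE). *)
Definition grp_unit (T : choiceType) : free_monoid T -> free_group T :=
  fm_lift (@fg_gen T).

HB.instance Definition _ (T : choiceType) :=
  UMagmaMorphism.copy (@grp_unit T) (fm_lift (@fg_gen T)).

Lemma grp_unit_univ (T : choiceType) (G : groupType)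
    (h : monoid_hom (free_monoid T) G) :
  exists! hh : monoid_hom (free_group T) G, forall w, hh (grp_unit w) = h w.
Proof.
exists (fg_lift (fun i => h (fm_gen i))); split=> [w|hh hhE].
  rewrite /grp_unit /fm_lift gmulf_prod [RHS]fm_homE.
  by apply: eq_bigr => i _; exact: fg_liftE.
apply: monoid_homP => w; rewrite [RHS]fg_homE; congr (fg_lift _ w).
by apply/funext => i /=; rewrite -hhE /grp_unit fm_liftE.
Qed.

Definition grp_hom k l (f : mon_hom k l) : gr_hom k l :=
  gr_ext (fun i => grp_unit (f (fm_gen i))).

Lemma grp_homE k l (f : mon_hom k l) w :
  grp_hom f (grp_unit w) = grp_unit (f w).
Proof.
rewrite [f w]fm_homE; elim: w => [|i w IH].
  by rewrite {1}/grp_unit !fm_lift_nil !gmulf1.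
rewrite {1}/grp_unit !fm_lift_cons !gmulfM IH; congr (_ * _)%g.
by rewrite gr_extE.
Qed.

Lemma grp_hom1 k : grp_hom (mon_id k) = gr_id k.
Proof. by apply: gr_homP => i; rewrite gr_extE /grp_unit fm_liftE. Qed.

Lemma grp_homM k l m (g : mon_hom l m) (f : mon_hom k l) :
  grp_hom (mon_comp g f) = gr_comp (grp_hom g) (grp_hom f).
Proof. by apply: gr_homP => i; rewrite /= !gr_extE grp_homE. Qed.

Definition groupification : functor mon gr :=
  @Functor mon gr id grp_hom grp_hom1 grp_homM.

End Groupification.

Notation "'Z[' N ]" := {freeg N / int} (at level 8, format "'Z[' N ]").

Section AugmentationIdeal.
Variable N : choiceType.

Definition aug_pred : {pred Z[N]} := fun x => deg x == 0.

Lemma aug_pred_closed : zmod_closed aug_pred.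
Proof.
split=> [|x y]; rewrite /aug_pred !unfold_in ?raddf0 // => /eqP x0 /eqP y0.
by rewrite raddfB /= x0 y0 subr0.
Qed.
HB.instance Definition _ := GRing.isZmodClosed.Build Z[N] aug_pred aug_pred_closed.

Record aug_ideal := AugIdeal { aug_val :> Z[N]; aug_valP : aug_val \in aug_pred }.
HB.instance Definition _ := [isSub for aug_val].
HB.instance Definition _ := [Choice of aug_ideal by <:].
HB.instance Definition _ := [SubChoice_isSubZmodule of aug_ideal by <:].

End AugmentationIdeal.

(* The linear extension Z[N]^{(x) m} -> V of F : N^m -> V, evaluated at
   y_1 (x) ... (x) y_m. *)
Fixpoint mlext (N : choiceType) (V : lmodType int) (m : nat) :
    (m.-tuple N -> V) -> m.-tuple Z[N] -> V :=
  if m is m'.+1 then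
    fun F y => fglift (fun x => mlext (fun s => F [tuple of x :: s])
                                      [tuple of behead y]) (thead y)
  else fun F _ => F [tuple].

Definition theta_bar (N : choiceType) m (theta : m.-tuple N -> N) :
  m.-tuple Z[N] -> Z[N] := mlext (fun x => << theta x >>).

(* The additive subgroup of V generated by S. *)
Inductive zspan (V : zmodType) (S : V -> Prop) : V -> Prop :=
| zspan0 : zspan S 0
| zspan_gen x of S x : zspan S x
| zspanB x y of zspan S x & zspan S y : zspan S (x - y).

(* A family of m-ary operations on N, for every m. *)
Definition opset (N : Type) := forall m, (m.-tuple N -> N) -> Prop.

(* The subgroup sum_{m >= n} sum_{theta in Theta m} theta_bar (I(N)^{(x) m}):
   the image of I(N)^{(x) m} is spanned by the values of theta_bar on the
   elementary tensors y_1 (x) ... (x) y_m with all y_i in I(N). *)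
Definition ideal_power (N : choiceType) (Theta : opset N) (n : nat) : Z[N] -> Prop :=
  zspan (fun z => exists m (theta : m.-tuple N -> N) (y : m.-tuple Z[N]),
    [/\ (n <= m)%N, Theta m theta, (forall i, tnth y i \in @aug_pred N)
      & z = theta_bar theta y]).

Definition As_ops (N : monoidType) : opset N := fun m theta =>
  exists s : 'S_m, theta = fun x => (\prod_(i < m) tnth x (s i))%g.

Definition Gr_ops (G : groupType) : opset G := fun m theta =>
  exists w : free_group 'I_m, theta = fun x => fg_lift (tnth x) w.

Section Pn.
Variables (n : nat) (N : choiceType) (Theta : opset N).

Definition ideal_power_pred : {pred aug_ideal N} :=
  fun x => `[< ideal_power Theta n.+1 (aug_val x) >].

Lemma ideal_power_closed : zmod_closed ideal_power_pred.
Proof.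
split=> [|x y]; rewrite /ideal_power_pred !unfold_in.
  by apply/asboolP; exact: zspan0.
by move=> /asboolP hx /asboolP hy; apply/asboolP; exact: zspanB.
Qed.
HB.instance Definition _ :=
  GRing.isZmodClosed.Build (aug_ideal N) ideal_power_pred ideal_power_closed.

Definition Pn : zmodType := Quotient.quot ideal_power_pred.

Definition pn_pi (x : aug_ideal N) : Pn :=
  (\pi_(Quotient.quot ideal_power_pred) x)%qT.

Definition pn_repr (F : Pn) : aug_ideal N :=
  generic_quotient.repr (F : Quotient.quot ideal_power_pred).

Lemma pn_reprK : cancel pn_repr pn_pi.
Proof. exact: reprK. Qed.

Lemma pn_pi_eq x y :
  pn_pi x = pn_pi y <-> ideal_power Theta n.+1 (aug_val x - aug_val y).
Proof.
rewrite -[_ - _]/(aug_val (x - y)); split=> [/eqP|hxy].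
  by rewrite /pn_pi -Quotient.idealrBE => /asboolP.
by apply/eqP; rewrite /pn_pi -Quotient.idealrBE; exact/asboolP.
Qed.

Lemma pn_piB : {morph pn_pi : x y / x - y}.
Proof. by move=> x y; rewrite /pn_pi raddfB. Qed.

Lemma pn_piD : {morph pn_pi : x y / x + y}.
Proof. by move=> x y; rewrite /pn_pi raddfD. Qed.
End Pn.
Arguments pn_pi {n N Theta} x.
Arguments pn_repr {n N Theta} F.

Section LinearExtension.
Variables (N : choiceType) (V : lmodType int).
Implicit Types (F : N -> V) (x y : Z[N]).

Lemma fgliftB F x y : fglift F (x - y) = fglift F x - fglift F y.
Proof. exact: lift_is_additive. Qed.

Lemma fglift0 F : fglift F 0 = 0.
Proof. by rewrite -[X in fglift F X](subrr (0 : Z[N])) fgliftB subrr. Qed.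

Lemma fgliftN F x : fglift F (- x) = - fglift F x.
Proof. by rewrite -[- x]sub0r fgliftB fglift0 sub0r. Qed.

Lemma fgliftD F x y : fglift F (x + y) = fglift F x + fglift F y.
Proof. by rewrite -[X in _ + X]opprK fgliftB fgliftN opprK. Qed.

Lemma fgliftU1 F a : fglift F << a >> = F a.
Proof. by rewrite liftU scale1r. Qed.

Lemma Zind (P : Z[N] -> Prop) : P 0 -> (forall x y, P x -> P y -> P (x - y)) ->
  (forall a, P << a >>) -> forall x, P x.
Proof.
move=> P0 PB PU x; rewrite -(freeg_sumE x).
have PN z : P z -> P (- z) by move=> Pz; rewrite -sub0r; exact: PB.
have PD z t : P z -> P t -> P (z + t).
  by move=> Pz Pt; rewrite -[t]opprK; apply/PB/PN.
have PM m a : P << m%:Z *g a >>.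
  elim: m => [|m IH]; first by rewrite freegU0.
  by rewrite intS -freegUD; exact: PD.
elim/big_ind: _ => // a _; case: (coeff a x) => m //.
by rewrite NegzE -freegUN; apply: PN.
Qed.

Lemma fglift_ext F (f : Z[N] -> V) : {morph f : x y / x - y} ->
  (forall a, f << a >> = F a) -> f =1 fglift F.
Proof.
move=> fB fU; apply: Zind => [|x y fx fy|a].
- by rewrite fglift0 -(subrr (0 : Z[N])) fB subrr.
- by rewrite fB fgliftB fx fy.
- by rewrite fU fgliftU1.
Qed.

Lemma fglift_cst (c : V) x : fglift (fun=> c) x = c *~ deg x.
Proof.
elim/Zind: x => [|x y hx hy|a]; first by rewrite fglift0 raddf0.
  by rewrite fgliftB hx hy raddfB /= mulrzBr.
by rewrite fgliftU1 degU.
Qed.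

Lemma fglift_addF (F G : N -> V) x :
  fglift (fun a => F a + G a) x = fglift F x + fglift G x.
Proof.
elim/Zind: x => [|x y hx hy|a]; first by rewrite !fglift0 addr0.
  by rewrite !fgliftB hx hy opprD addrACA.
by rewrite !fgliftU1.
Qed.

End LinearExtension.

Lemma fglift_morph (N : choiceType) (V W : lmodType int) (L : V -> W) (F : N -> V) x :
  {morph L : x y / x - y} -> L (fglift F x) = fglift (fun a => L (F a)) x.
Proof.
move=> LB; pose f x := L (fglift F x).
rewrite -/(f x); apply: fglift_ext => [y z|a]; rewrite /f ?fgliftU1 //.
by rewrite fgliftB LB.
Qed.

Section Mlext.
Variables (N : choiceType) (V : lmodType int).

Lemma mlextS m (F : m.+1.-tuple N -> V) y :
  mlext F y = fglift (fun x => mlext (fun s => F [tuple of x :: s])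
                               [tuple of behead y]) (thead y).
Proof. by []. Qed.

Lemma mlext_morph (W : lmodType int) (L : V -> W) m (F : m.-tuple N -> V) y :
  {morph L : x y / x - y} -> L (mlext F y) = mlext (fun x => L (F x)) y.
Proof.
move=> LB; elim: m F y => [//|m IH] F y; rewrite !mlextS fglift_morph //.
by congr (fglift _ _); apply/funext => x; rewrite IH.
Qed.

Lemma mlext_add m (F G : m.-tuple N -> V) y :
  mlext (fun x => F x + G x) y = mlext F y + mlext G y.
Proof.
elim: m F G y => [//|m IH] F G y; rewrite !mlextS -fglift_addF.
by congr (fglift _ _); apply/funext => x; rewrite IH.
Qed.

Lemma zspanN (S : V -> Prop) x : zspan S x -> zspan S (- x).
Proof. by move=> ?; rewrite -sub0r; apply: zspanB => //; exact: zspan0. Qed.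

Lemma zspanD (S : V -> Prop) x y : zspan S x -> zspan S y -> zspan S (x + y).
Proof. by move=> ? ?; rewrite -[y]opprK; apply/zspanB/zspanN. Qed.

Lemma zspan_fglift (S : V -> Prop) (F : N -> V) (y : Z[N]) :
  (forall x, zspan S (F x)) -> zspan S (fglift F y).
Proof.
move=> SF; elim/Zind: y => [|x y hx hy|a].
- by rewrite fglift0; exact: zspan0.
- by rewrite fgliftB; exact: zspanB.
- by rewrite fgliftU1.
Qed.

Lemma zspan_mlext (S : V -> Prop) m (F : m.-tuple N -> V) y :
  (forall x, zspan S (F x)) -> zspan S (mlext F y).
Proof.
elim: m F y => [|m IH] F y SF //=; apply: zspan_fglift => x; exact: IH.
Qed.

Lemma mlext_indep (a0 : N) m (F : m.-tuple N -> V) y i :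
  (forall x x' : m.-tuple N, (forall j, j != i -> tnth x j = tnth x' j) ->
    F x = F x') ->
  tnth y i \in @aug_pred N -> mlext F y = 0.
Proof.
elim: m F y i => [|m IH] F y i; first by case: i.
move=> Find; rewrite mlextS; case: (unliftP ord0 i) => [i'|] iE yi.
  rewrite (_ : (fun _ => _) = fun=> 0) ?fglift_cst ?mul0rz //.
  apply/funext => x; apply: (IH _ _ i') => [s s' ss'|].
    apply: Find => j; rewrite iE; case: (unliftP ord0 j) => [j'|] -> ji.
      by rewrite !tnthS ss' //; apply: contra ji => /eqP->.
    by rewrite !tnth0.
  move: yi; rewrite iE; case/tupleP: y => z y; rewrite tnthS => yi.
  have -> : [tuple of behead [tuple of z :: y]] = y :> m.-tuple _ by exact/val_inj.
  by [].
rewrite (_ : (fun _ => _) = fun=> mlext (fun s => F [tuple of a0 :: s])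
                                   [tuple of behead y]).
  by rewrite fglift_cst; move: yi; rewrite iE => /eqP ->.
apply/funext => x; congr (mlext _ _); apply/funext => s.
apply: Find => j; rewrite iE; case: (unliftP ord0 j) => [j'|] -> //.
by rewrite !tnthS.
Qed.

Lemma mlext_gen m (F : m.-tuple N -> V) (x : m.-tuple N) :
  mlext F [tuple << tnth x i >> | i < m] = F x.
Proof.
elim: m F x => [|m IH] F x; first by rewrite [x]tuple0.
case/tupleP: x => a x; rewrite mlextS [thead _]tnth_mktuple tnth0 fgliftU1.
rewrite -[RHS](IH (fun s => F [tuple of a :: s])); congr (mlext _ _).
apply/eq_from_tnth => i; rewrite tnth_behead !tnth_mktuple.
by rewrite (_ : inord _ = fintype.lift ord0 i) ?tnthS //; apply/val_inj;
  rewrite /= inordK // ltnS.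
Qed.

End Mlext.

Section PointedProducts.
Variables (N M : monoidType).

(* Maps x |-> psi_1(x_{i_1}) * ... * psi_r(x_{i_r}) with all psi_j(1) = 1; the
   linear extension of such a map preserves the augmentation powers, which makes
   the composition well defined on the quotients. *)
Inductive pprod m : (m.-tuple N -> M) -> Prop :=
| pprod1 : pprod (fun=> 1%g)
| pprodM (i : 'I_m) (psi : N -> M) phi of psi 1%g = 1%g & pprod phi :
    pprod (fun x => psi (tnth x i) * phi x)%g.

Lemma pprod_mul m (phi phi' : m.-tuple N -> M) :
  pprod phi -> pprod phi' -> pprod (fun x => phi x * phi' x)%g.
Proof.
move=> hphi hphi'; elim: hphi => [|i psi phi0 psi1 _ IH].
  by rewrite (_ : (fun _ => _) = phi') //; apply/funext => x; rewrite mul1g.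
rewrite (_ : (fun _ => _) = fun x => psi (tnth x i) * (phi0 x * phi' x))%g.
  exact: pprodM.
by apply/funext => x; rewrite mulgA.
Qed.

Lemma pprod_single m (i : 'I_m) (psi : N -> M) : psi 1%g = 1%g ->
  pprod (fun x : m.-tuple N => psi (tnth x i)).
Proof.
move=> psi1; have := pprodM i psi1 (@pprod1 m).
by rewrite (_ : (fun _ => _) = fun x => psi (tnth x i)) //;
  apply/funext => x; rewrite mulg1.
Qed.

Lemma pprod_prod m I (r : seq I) (phi : I -> m.-tuple N -> M) :
  (forall i, pprod (phi i)) -> pprod (fun x => \prod_(i <- r) phi i x)%g.
Proof.
move=> h; elim: r => [|i r IH].
  rewrite (_ : (fun _ => _) = fun=> 1%g); first exact: pprod1.
  by apply/funext => x; rewrite big_nil.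
rewrite (_ : (fun _ => _) = fun x => phi i x * \prod_(i <- r) phi i x)%g.
  exact: pprod_mul.
by apply/funext => x; rewrite big_cons.
Qed.

Definition ztrans (a : M) : Z[M] -> Z[M] := fglift (fun b => << (a * b)%g >>).

(* ([a_1] - [1]) * ... * ([a_r] - [1]) in Z[M]. *)
Definition dprod (s : seq M) : Z[M] :=
  foldr (fun a z => ztrans a z - z) << 1%g >> s.

Lemma ztransB a : {morph ztrans a : x y / x - y}.
Proof. by move=> x y; exact: fgliftB. Qed.

Lemma dprod_mlext m (s : m.-tuple M) :
  dprod s = mlext (fun x : m.-tuple M => << (\prod_(i < m) tnth x i)%g >>)
    [tuple << tnth s i >> - << 1%g >> | i < m].
Proof.
elim: m s => [|m IH] s; first by rewrite tuple0 /= big_ord0.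
case/tupleP: s => a s; rewrite mlextS (_ : thead _ = << a >> - << 1%g >>); last first.
  by rewrite [thead _]tnth_mktuple tnth0.
rewrite fgliftB !fgliftU1.
have -> : [tuple of behead [tuple (<< tnth [tuple of a :: s] i >> - << 1%g >> : Z[M])
      | i < m.+1]] = [tuple << tnth s i >> - << 1%g >> | i < m] :> m.-tuple Z[M].
  apply/eq_from_tnth => i; rewrite tnth_mktuple tnth_behead tnth_mktuple.
  by rewrite (_ : inord _ = fintype.lift ord0 i) ?tnthS //; apply/val_inj;
    rewrite /= inordK // ltnS.
rewrite /= IH /ztrans; congr (_ - _); first rewrite -/(ztrans a _) mlext_morph.
- by congr (mlext _ _); apply/funext => x; rewrite /ztrans fgliftU1 big_ord_recl
    tnth0; congr (<< (_ * _)%g >>); apply: eq_bigr => i _; rewrite tnthS.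
- exact: ztransB.
- congr (mlext _ _); apply/funext => x; rewrite big_ord_recl tnth0 mul1g.
  by congr (<< _ >>); apply: eq_bigr => i _; rewrite tnthS.
Qed.

Inductive dsum m : (m.-tuple N -> Z[M]) -> Prop :=
| dsum_term (ls : seq 'I_m) (as_ : m.-tuple N -> seq M)
    of (forall x, size (as_ x) = size ls)
     & (forall x x' : m.-tuple N, {in ls, tnth x =1 tnth x'} -> as_ x = as_ x') :
    dsum (fun x => dprod (as_ x))
| dsumD F G of dsum F & dsum G : dsum (fun x => F x + G x).

Lemma dsum_ztrans m (i : 'I_m) (psi : N -> M) (F : m.-tuple N -> Z[M]) :
  dsum F -> dsum (fun x => ztrans (psi (tnth x i)) (F x)).
Proof.
elim=> [ls as_ sz dep|F' G _ hF _ hG].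
  rewrite (_ : (fun _ => _) = fun x =>
    dprod (psi (tnth x i) :: as_ x) + dprod (as_ x)); last first.
    by apply/funext => x /=; rewrite subrK.
  apply: dsumD; last exact: dsum_term dep.
  apply: (@dsum_term _ (i :: ls)) => [x|x x' xx'] /=; first by rewrite sz.
  rewrite xx' ?mem_head // (dep x x') // => j jl.
  by rewrite xx' // inE jl orbT.
rewrite (_ : (fun _ => _) = fun x =>
  ztrans (psi (tnth x i)) (F' x) + ztrans (psi (tnth x i)) (G x)).
  exact: dsumD.
by apply/funext => x; exact: fgliftD.
Qed.

Lemma pprod_dsum m (phi : m.-tuple N -> M) :
  pprod phi -> dsum (fun x => << phi x >>).
Proof.
elim=> [|i psi phi' _ _ IH].
  exact: (@dsum_term m [::] (fun=> [::])).
rewrite (_ : (fun _ => _) = fun x => ztrans (psi (tnth x i)) << phi' x >>).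
  exact: dsum_ztrans.
by apply/funext => x; rewrite /ztrans fgliftU1.
Qed.

Variables (n : nat) (Theta : opset M).
Hypothesis As_Theta : forall m (theta : m.-tuple M -> M),
  As_ops theta -> Theta theta.

Lemma dprod_power s : (n <= size s)%N -> ideal_power Theta n (dprod s).
Proof.
move=> ns; apply: zspan_gen; exists (size s).
exists (fun x => \prod_(i < size s) tnth x ((1%g : 'S__) i))%g.
exists [tuple << tnth (in_tuple s) i >> - << 1%g >> | i < size s].
split=> //; first by apply: As_Theta; exists 1%g.
  move=> i; rewrite tnth_mktuple /aug_pred unfold_in raddfB /= !degU.
  by rewrite subrr.
rewrite -[LHS]/(dprod (in_tuple s)) dprod_mlext /theta_bar.
congr (mlext _ _); apply/funext => x; congr (<< _ >>).
by apply: eq_bigr => i _; rewrite perm1.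
Qed.

Lemma pprod_power m (phi : m.-tuple N -> M) (y : m.-tuple Z[N]) :
  pprod phi -> (n <= m)%N -> (forall i, tnth y i \in @aug_pred N) ->
  ideal_power Theta n (mlext (fun x => << phi x >>) y).
Proof.
move=> /pprod_dsum hphi nm yI.
elim: hphi => [ls as_ sz dep|F G _ hF _ hG]; last first.
  by rewrite mlext_add; exact: zspanD.
have [/forallP all_ls|] := boolP [forall i : 'I_m, i \in ls].
  apply: zspan_mlext => x; apply: dprod_power; rewrite sz (leq_trans nm) //.
  rewrite -[X in (X <= _)%N]card_ord cardE.
  by apply: uniq_leq_size; rewrite ?enum_uniq.
rewrite negb_forall => /existsP[i ils].
rewrite (mlext_indep 1%g _ (yI i)); first exact: zspan0.
move=> x x' xx'; congr dprod; apply: dep => j jl; apply: xx'.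
by apply: contraNneq ils => <-.
Qed.

End PointedProducts.

Section PprodClosure.
Variables (N M P : monoidType).

Lemma pprod_hom (h : monoid_hom M P) m (phi : m.-tuple N -> M) :
  pprod phi -> pprod (fun x => h (phi x)).
Proof.
elim=> [|i psi phi' psi1 _ IH].
  rewrite (_ : (fun _ => _) = fun=> 1%g); first exact: pprod1.
  by apply/funext => x; rewrite gmulf1.
rewrite (_ : (fun _ => _) = fun x => h (psi (tnth x i)) * h (phi' x))%g.
  by apply: (pprodM i (psi := fun a => h (psi a))) => //; rewrite psi1 gmulf1.
by apply/funext => x; rewrite gmulfM.
Qed.

Variables (n : nat) (Theta : opset N) (Theta' : opset M).
Hypothesis As_Theta : forall m (theta : m.-tuple M -> M),
  As_ops theta -> Theta' theta.

Lemma ideal_power_fglift (A : N -> M) :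
  (forall m (theta : m.-tuple N -> N), Theta theta -> pprod (fun x => A (theta x))) ->
  forall y, ideal_power Theta n y ->
  ideal_power Theta' n (fglift (fun a => << A a >>) y).
Proof.
move=> hA y; elim=> [|_ [m [theta [{}y [nm Tth yI ->]]]]|{}y z _ hy _ hz].
- by rewrite fglift0; exact: zspan0.
- rewrite /theta_bar mlext_morph; last exact: fgliftB.
  rewrite (_ : (fun _ => _) = fun x => << A (theta x) >>).
    by apply: pprod_power => //; exact: hA.
  by apply/funext => x; rewrite fgliftU1.
- by rewrite fgliftB; exact: zspanB.
Qed.

End PprodClosure.

Lemma pprod_inv (N : monoidType) (G : groupType) m (phi : m.-tuple N -> G) :
  pprod phi -> pprod (fun x => (phi x)^-1%g).
Proof.
elim=> [|i psi phi' psi1 _ IH].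
  rewrite (_ : (fun _ => _) = fun=> 1%g); first exact: pprod1.
  by apply/funext => x; rewrite invg1.
rewrite (_ : (fun _ => _) = fun x => (phi' x)^-1 * (psi (tnth x i))^-1)%g.
  apply: pprod_mul => //; apply: (pprod_single i (psi := fun a => (psi a)^-1%g)).
  by rewrite psi1 invg1.
by apply/funext => x; rewrite invgM.
Qed.

Lemma As_pprod (N : monoidType) m (theta : m.-tuple N -> N) :
  As_ops theta -> pprod theta.
Proof.
by case=> s ->; apply: pprod_prod => i; exact: (pprod_single _ (psi := id)).
Qed.

Lemma pprod_fg_lift (N : monoidType) (G : groupType) (T : choiceType) m
    (phi : T -> m.-tuple N -> G) (w : free_group T) :
  (forall i, pprod (phi i)) -> pprod (fun x => fg_lift (fun i => phi i x) w).
Proof.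
move=> h; apply: pprod_prod => -[i []]; rewrite /letter_val //=.
exact: pprod_inv.
Qed.

Lemma Gr_pprod (G : groupType) m (theta : m.-tuple G -> G) :
  Gr_ops theta -> pprod theta.
Proof.
case=> w ->; apply: pprod_fg_lift => i; exact: (pprod_single _ (psi := id)).
Qed.

Lemma As_Gr (G : groupType) m (theta : m.-tuple G -> G) :
  As_ops theta -> Gr_ops theta.
Proof.
case=> s ->; exists (\prod_(i < m) fg_gen (s i))%g; apply/funext => x.
by rewrite gmulf_prod; apply: eq_bigr => i _; exact/esym/fg_liftE.
Qed.

Section PnUnit.
Variables (n : nat) (N : monoidType) (Theta : opset N).

Lemma aug_gen_subproof (x : N) : << x >> - << 1%g >> \in @aug_pred N.
Proof. by rewrite /aug_pred unfold_in raddfB /= !degU subrr. Qed.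

Definition aug_gen (x : N) : aug_ideal N := AugIdeal (aug_gen_subproof x).

(* The class of x - 1. *)
Definition pn (x : N) : Pn n Theta := pn_pi (aug_gen x).

End PnUnit.

Section LinearizedCategory.
Variables (n : nat) (H : nat -> nat -> monoidType).
Variables (idH : forall a, H a a) (compH : forall a b c, H b c -> H a b -> H a c).
Hypothesis compH1m : forall a b (f : H a b), compH (idH b) f = f.
Hypothesis compHm1 : forall a b (f : H a b), compH f (idH a) = f.
Hypothesis compHA : forall a b c d (h : H c d) (g : H b c) (f : H a b),
  compH h (compH g f) = compH (compH h g) f.
Hypothesis compH1 : forall a b c (f : H a b), compH (1%g : H b c) f = 1%g.
Hypothesis comp1H : forall a b c (g : H b c), compH g (1%g : H a b) = 1%g.
Variable Theta : forall a b, opset (H a b).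
Local Notation I a b := (aug_ideal (H a b)).
Local Notation power := (@ideal_power _ (@Theta _ _) n.+1).
Local Notation P a b := (Pn n (@Theta a b)).
Hypothesis power_compl : forall a b c (g : H b c) (y : Z[H a b]),
  power y -> power (fglift (fun f => << compH g f >> : Z[H a c]) y).
Hypothesis power_compr : forall a b c (f : H a b) (x : Z[H b c]),
  power x -> power (fglift (fun g => << compH g f >> : Z[H a c]) x).

Definition zcomp a b c (x : Z[H b c]) (y : Z[H a b]) : Z[H a c] :=
  fglift (fun g => fglift (fun f => << compH g f >> : Z[H a c]) y) x.

Lemma zcompBl a b c (x x' : Z[H b c]) (y : Z[H a b]) :
  zcomp (x - x') y = zcomp x y - zcomp x' y.
Proof. exact: fgliftB. Qed.

Lemma zcompE a b c (x : Z[H b c]) (y : Z[H a b]) :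
  zcomp x y = fglift (fun f => fglift (fun g => << compH g f >>) x) y.
Proof.
rewrite /zcomp [RHS](_ : _ = (fun x => fglift (fun f =>
  fglift (fun g => << compH g f >>) x) y) x) //.
symmetry; move: x; apply: fglift_ext => [x x'|g].
  elim/Zind: y => [|y z hy hz|f]; first by rewrite !fglift0 subrr.
    rewrite [LHS]fgliftB hy hz [X in _ = X - _]fgliftB [X in _ = _ - X]fgliftB.
    by rewrite !opprB addrACA [RHS]addrACA; congr (_ + _); rewrite addrC.
  by rewrite !fgliftU1 fgliftB.
by congr (fglift _ _); apply/funext => f; rewrite fgliftU1.
Qed.

Lemma zcompBr a b c (x : Z[H b c]) (y y' : Z[H a b]) :
  zcomp x (y - y') = zcomp x y - zcomp x y'.
Proof. by rewrite !zcompE; exact: fgliftB. Qed.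

Lemma zcompU a b c (g : H b c) (f : H a b) :
  zcomp << g >> << f >> = << compH g f >>.
Proof. by rewrite /zcomp !fgliftU1. Qed.

Lemma zcompUl a b c (g : H b c) (y : Z[H a b]) :
  zcomp << g >> y = fglift (fun f => << compH g f >>) y.
Proof. by rewrite /zcomp fgliftU1. Qed.

Lemma zcompUr a b c (x : Z[H b c]) (f : H a b) :
  zcomp x << f >> = fglift (fun g => << compH g f >>) x.
Proof. by rewrite zcompE fgliftU1. Qed.

Lemma zcomp0l a b c (y : Z[H a b]) : zcomp (0 : Z[H b c]) y = 0.
Proof. exact: fglift0. Qed.

Lemma zcomp0r a b c (x : Z[H b c]) : zcomp x (0 : Z[H a b]) = 0.
Proof. by rewrite zcompE fglift0. Qed.

Lemma deg_zcomp a b c (x : Z[H b c]) (y : Z[H a b]) :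
  deg (zcomp x y) = deg x * deg y.
Proof.
elim/Zind: x => [|x x' hx hx'|g].
- by rewrite zcomp0l !raddf0 mul0r.
- by rewrite zcompBl !raddfB /= hx hx' mulrBl.
elim/Zind: y => [|y y' hy hy'|f].
- by rewrite zcomp0r !raddf0 mulr0.
- by rewrite zcompBr !raddfB /= hy hy' mulrBr.
- by rewrite zcompU !degU.
Qed.

Lemma zcomp_power_l a b c (x : Z[H b c]) (y : Z[H a b]) :
  power x -> power (zcomp x y).
Proof.
move=> hx; elim/Zind: y => [|y y' hy hy'|f].
- by rewrite zcomp0r; exact: zspan0.
- by rewrite zcompBr; exact: zspanB.
- by rewrite zcompUr; exact: power_compr.
Qed.

Lemma zcomp_power_r a b c (x : Z[H b c]) (y : Z[H a b]) :
  power y -> power (zcomp x y).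
Proof.
move=> hy; elim/Zind: x => [|x x' hx hx'|g].
- by rewrite zcomp0l; exact: zspan0.
- by rewrite zcompBl; exact: zspanB.
- by rewrite zcompUl; exact: power_compl.
Qed.

Lemma zcompA a b c d (x : Z[H c d]) (y : Z[H b c]) (z : Z[H a b]) :
  zcomp x (zcomp y z) = zcomp (zcomp x y) z.
Proof.
elim/Zind: x => [|x x' hx hx'|h]; first by rewrite !zcomp0l.
  by rewrite !zcompBl hx hx'.
elim/Zind: y => [|y y' hy hy'|g]; first by rewrite zcomp0l !zcomp0r zcomp0l.
  by rewrite zcompBl !zcompBr zcompBl hy hy'.
elim/Zind: z => [|z z' hz hz'|f]; first by rewrite !zcomp0r.
  by rewrite !zcompBr hz hz'.
by rewrite !zcompU compHA.
Qed.

Lemma zcomp1l a b c (y : Z[H a b]) :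
  zcomp << 1%g : H b c >> y = << 1%g >> *~ deg y.
Proof.
rewrite zcompUl -fglift_cst; congr (fglift _ _); apply/funext => f.
by rewrite compH1.
Qed.

Lemma zcomp1r a b c (x : Z[H b c]) :
  zcomp x << 1%g : H a b >> = << 1%g >> *~ deg x.
Proof.
rewrite zcompUr -fglift_cst; congr (fglift _ _); apply/funext => f.
by rewrite comp1H.
Qed.

Lemma zcomp_id_l a b (y : Z[H a b]) : zcomp << idH b >> y = y.
Proof.
elim/Zind: y => [|y y' hy hy'|f]; first by rewrite zcomp0r.
  by rewrite zcompBr hy hy'.
by rewrite zcompU compH1m.
Qed.

Lemma zcomp_id_r a b (x : Z[H a b]) : zcomp x << idH a >> = x.
Proof.
elim/Zind: x => [|y y' hy hy'|f]; first by rewrite zcomp0l.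
  by rewrite zcompBl hy hy'.
by rewrite zcompU compHm1.
Qed.

Lemma acomp_subproof a b c (x : I b c) (y : I a b) :
  zcomp x y \in @aug_pred (H a c).
Proof.
rewrite /aug_pred unfold_in deg_zcomp.
by have /eqP -> := aug_valP x; rewrite mul0r.
Qed.

Definition acomp a b c (x : I b c) (y : I a b) : I a c :=
  AugIdeal (acomp_subproof x y).

(* Independent of the representatives by lcomp_pi, and determined by bilinearity
   and lcomp_pn. *)
Definition lcomp a b c (G : P b c) (F : P a b) : P a c :=
  pn_pi (acomp (pn_repr G) (pn_repr F)).

Lemma lcomp_pi a b c (x : I b c) (y : I a b) :
  lcomp (pn_pi x) (pn_pi y) = pn_pi (acomp x y).
Proof.
apply/pn_pi_eq => /=; set x' := pn_repr _; set y' := pn_repr _.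
have hx : power (aug_val x' - aug_val x) by apply/pn_pi_eq; exact: pn_reprK.
have hy : power (aug_val y' - aug_val y) by apply/pn_pi_eq; exact: pn_reprK.
rewrite -(subrKA (zcomp x y')) -zcompBl -zcompBr.
by apply: zspanD; [exact: zcomp_power_l | exact: zcomp_power_r].
Qed.

Lemma pn_ind a b (Q : P a b -> Prop) :
  (forall x, Q (pn_pi x)) -> forall F, Q F.
Proof. by move=> hQ F; rewrite -[F]pn_reprK. Qed.

Lemma lcompDl a b c (G G' : P b c) (F : P a b) :
  lcomp (G + G') F = lcomp G F + lcomp G' F.
Proof.
elim/pn_ind: G => x; elim/pn_ind: G' => x'; elim/pn_ind: F => y.
rewrite -pn_piD !lcomp_pi -pn_piD; congr pn_pi; apply/val_inj => /=.
exact: fgliftD.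
Qed.

Lemma lcompDr a b c (G : P b c) (F F' : P a b) :
  lcomp G (F + F') = lcomp G F + lcomp G F'.
Proof.
elim/pn_ind: G => x; elim/pn_ind: F' => y'; elim/pn_ind: F => y.
rewrite -pn_piD !lcomp_pi -pn_piD; congr pn_pi; apply/val_inj => /=.
by rewrite !zcompE; exact: fgliftD.
Qed.

Lemma lcompA a b c d (K : P c d) (G : P b c) (F : P a b) :
  lcomp K (lcomp G F) = lcomp (lcomp K G) F.
Proof.
elim/pn_ind: K => x; elim/pn_ind: G => y; elim/pn_ind: F => z.
by rewrite !lcomp_pi; congr pn_pi; apply/val_inj; exact: zcompA.
Qed.

Lemma lcomp1m a b (F : P a b) : lcomp (pn n _ (idH b)) F = F.
Proof.
elim/pn_ind: F => y; rewrite lcomp_pi; congr pn_pi; apply/val_inj => /=.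
rewrite zcompBl zcomp_id_l zcomp1l.
by have /eqP -> := aug_valP y; rewrite mulr0z subr0.
Qed.

Lemma lcompm1 a b (F : P a b) : lcomp F (pn n _ (idH a)) = F.
Proof.
elim/pn_ind: F => y; rewrite lcomp_pi; congr pn_pi; apply/val_inj => /=.
rewrite zcompBr zcomp_id_r zcomp1r.
by have /eqP -> := aug_valP y; rewrite mulr0z subr0.
Qed.

Lemma lcomp_pn a b c (g : H b c) (f : H a b) :
  pn n (@Theta a c) (compH g f) = lcomp (pn n _ g) (pn n _ f).
Proof.
rewrite lcomp_pi; congr pn_pi; apply/val_inj => /=.
by rewrite zcompBl !zcompBr !zcompU compH1 comp1H compH1 subrr subr0.
Qed.

Definition linearized : preadditive :=
  @Preadditive nat (fun a b => P a b) (fun a => pn n _ (idH a)) lcomp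
    lcomp1m lcompm1 lcompA lcompDl lcompDr.

End LinearizedCategory.

Section PnAsMon.

Lemma mon_mulE k l (f g : mon_hom k l) i :
  (f * g)%g (fm_gen i) = (f (fm_gen i) * g (fm_gen i))%g.
Proof. exact: mon_extE. Qed.

Lemma mon_oneE k l i : (1%g : mon_hom k l) (fm_gen i) = 1%g.
Proof. exact: mon_extE. Qed.

Lemma mon_one_cst k l w : (1%g : mon_hom k l) w = 1%g.
Proof. by rewrite [LHS]fm_homE; apply: big1 => i _; exact: mon_oneE. Qed.

Lemma mon_comp1l k l m (f : mon_hom k l) : mon_comp (1%g : mon_hom l m) f = 1%g.
Proof. by apply: mon_homP => i; rewrite /= !mon_one_cst. Qed.

Lemma mon_comp1r k l m (g : mon_hom l m) : mon_comp g (1%g : mon_hom k l) = 1%g.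
Proof. by apply: mon_homP => i; rewrite /= !mon_one_cst gmulf1. Qed.

Definition mon_eval k l (j : 'I_k) (f : mon_hom k l) : free_monoid 'I_l :=
  f (fm_gen j).
Lemma mon_eval_morph k l j : monoid.monoid_morphism (@mon_eval k l j).
Proof. by split=> [|f g]; rewrite /mon_eval ?mon_oneE ?mon_mulE. Qed.
HB.instance Definition _ k l j :=
  isUMagmaMorphism.Build (mon_hom k l) _ (@mon_eval k l j) (@mon_eval_morph k l j).

Definition mon_delta k l (j : 'I_k) (w : free_monoid 'I_l) : mon_hom k l :=
  mon_ext (fun i => if i == j then w else 1%g).
Lemma mon_delta_morph k l j : monoid.monoid_morphism (@mon_delta k l j).
Proof.
split=> [|v w]; apply: mon_homP => i; rewrite ?mon_oneE ?mon_mulE !mon_extE.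
  by case: eqP.
by case: eqP; rewrite // mulg1.
Qed.
HB.instance Definition _ k l j :=
  isUMagmaMorphism.Build _ (mon_hom k l) (@mon_delta k l j) (@mon_delta_morph k l j).

Lemma mon_deltaE k l (f : mon_hom k l) :
  f = (\prod_(j < k) mon_delta j (f (fm_gen j)))%g.
Proof.
apply: mon_homP => i.
rewrite -[RHS]/(mon_eval i _) gmulf_prod.
rewrite (eq_bigr (fun j => if i == j then f (fm_gen j) else 1%g)); last first.
  by move=> j _; exact: mon_extE.
by rewrite -big_mkcond (big_pred1 i) // => j; rewrite eq_sym.
Qed.

Lemma mon_comp_morph k l m (g : mon_hom l m) :
  monoid.monoid_morphism (@mon_comp k l m g).
Proof.
split=> [|f f']; first exact: mon_comp1r.
by apply: mon_homP => i; rewrite mon_mulE /= mon_mulE gmulfM.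
Qed.
HB.instance Definition _ k l m (g : mon_hom l m) :=
  isUMagmaMorphism.Build (mon_hom k l) (mon_hom k m) (@mon_comp k l m g)
    (@mon_comp_morph k l m g).

Lemma mon_power_compl n k l m (g : mon_hom l m) (y : Z[mon_hom k l]) :
  ideal_power (@As_ops _) n y ->
  ideal_power (@As_ops _) n (fglift (fun f => << mon_comp g f >> : Z[mon_hom k m]) y).
Proof.
apply: ideal_power_fglift => // p theta /As_pprod; exact: pprod_hom.
Qed.

Lemma mon_power_compr n k l m (f : mon_hom k l) (x : Z[mon_hom l m]) :
  ideal_power (@As_ops _) n x ->
  ideal_power (@As_ops _) n (fglift (fun g => << mon_comp g f >> : Z[mon_hom k m]) x).
Proof.
apply: ideal_power_fglift => // p theta /As_pprod htheta.
rewrite (_ : (fun _ => _) = fun x => \prod_(j < k) mon_delta j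
    (fm_lift (fun i => mon_eval i (theta x)) (f (fm_gen j))))%g.
  apply: pprod_prod => j; apply: pprod_hom; apply: pprod_prod => i.
  exact: pprod_hom.
apply/funext => z; rewrite [LHS]mon_deltaE; apply: eq_bigr => j _ /=.
by rewrite [theta z _]fm_homE.
Qed.

Definition PnAs_mon (n : nat) : preadditive :=
  @linearized n (fun k l => mon_hom k l : monoidType) mon_id mon_comp
    mon_comp1m mon_compm1 mon_compA mon_comp1l mon_comp1r
    (fun k l => @As_ops (mon_hom k l))
    (@mon_power_compl n.+1) (@mon_power_compr n.+1).

Lemma p_As_comp n k l m (g : mon_hom l m) (f : mon_hom k l) :
  pn n (@As_ops _) (mon_comp g f) =
  pcomp (pn n (@As_ops _) g : @phom (PnAs_mon n) l m) (pn n (@As_ops _) f).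
Proof.
exact: (@lcomp_pn n (fun k l => mon_hom k l : monoidType) mon_comp
  mon_comp1l mon_comp1r (fun k l => @As_ops (mon_hom k l))
  (@mon_power_compl n.+1) (@mon_power_compr n.+1)).
Qed.

Definition p_As (n : nat) : functor mon (PnAs_mon n) :=
  @Functor mon (PnAs_mon n) id (fun k l => pn n (@As_ops (mon_hom k l)))
    (fun _ => erefl) (@p_As_comp n).

End PnAsMon.

Section PnGrGr.

Lemma gr_mulE k l (f g : gr_hom k l) i :
  (f * g)%g (fg_gen i) = (f (fg_gen i) * g (fg_gen i))%g.
Proof. exact: gr_extE. Qed.

Lemma gr_oneE k l i : (1%g : gr_hom k l) (fg_gen i) = 1%g.
Proof. exact: gr_extE. Qed.

Lemma gr_one_cst k l w : (1%g : gr_hom k l) w = 1%g.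
Proof.
rewrite [LHS]fg_homE; apply: big1 => -[i b] _.
by rewrite /letter_val /= gr_oneE invg1; case: b.
Qed.

Lemma gr_comp1l k l m (f : gr_hom k l) : gr_comp (1%g : gr_hom l m) f = 1%g.
Proof. by apply: gr_homP => i; rewrite /= !gr_one_cst. Qed.

Lemma gr_comp1r k l m (g : gr_hom l m) : gr_comp g (1%g : gr_hom k l) = 1%g.
Proof. by apply: gr_homP => i; rewrite /= !gr_one_cst gmulf1. Qed.

Definition gr_eval k l (j : 'I_k) (f : gr_hom k l) : free_group 'I_l :=
  f (fg_gen j).
Lemma gr_eval_morph k l j : monoid.monoid_morphism (@gr_eval k l j).
Proof. by split=> [|f g]; rewrite /gr_eval ?gr_oneE ?gr_mulE. Qed.
HB.instance Definition _ k l j :=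
  isUMagmaMorphism.Build (gr_hom k l) _ (@gr_eval k l j) (@gr_eval_morph k l j).

Definition gr_delta k l (j : 'I_k) (w : free_group 'I_l) : gr_hom k l :=
  gr_ext (fun i => if i == j then w else 1%g).
Lemma gr_delta_morph k l j : monoid.monoid_morphism (@gr_delta k l j).
Proof.
split=> [|v w]; apply: gr_homP => i; rewrite ?gr_oneE ?gr_mulE !gr_extE.
  by case: eqP.
by case: eqP; rewrite // mulg1.
Qed.
HB.instance Definition _ k l j :=
  isUMagmaMorphism.Build _ (gr_hom k l) (@gr_delta k l j) (@gr_delta_morph k l j).

Lemma gr_deltaE k l (f : gr_hom k l) :
  f = (\prod_(j < k) gr_delta j (f (fg_gen j)))%g.
Proof.
apply: gr_homP => i; rewrite -[RHS]/(gr_eval i _) gmulf_prod.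
rewrite (eq_bigr (fun j => if i == j then f (fg_gen j) else 1%g)); last first.
  by move=> j _; exact: gr_extE.
by rewrite -big_mkcond (big_pred1 i) // => j; rewrite eq_sym.
Qed.

Lemma gr_comp_morph k l m (g : gr_hom l m) :
  monoid.monoid_morphism (@gr_comp k l m g).
Proof.
split=> [|f f']; first exact: gr_comp1r.
by apply: gr_homP => i; rewrite gr_mulE /= gr_mulE gmulfM.
Qed.
HB.instance Definition _ k l m (g : gr_hom l m) :=
  isUMagmaMorphism.Build (gr_hom k l) (gr_hom k m) (@gr_comp k l m g)
    (@gr_comp_morph k l m g).

Lemma gr_power_compl n k l m (g : gr_hom l m) (y : Z[gr_hom k l]) :
  ideal_power (@Gr_ops _) n y ->
  ideal_power (@Gr_ops _) n (fglift (fun f => << gr_comp g f >> : Z[gr_hom k m]) y).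
Proof.
apply: ideal_power_fglift => [p theta|p theta /Gr_pprod]; first exact: As_Gr.
exact: pprod_hom.
Qed.

Lemma gr_power_compr n k l m (f : gr_hom k l) (x : Z[gr_hom l m]) :
  ideal_power (@Gr_ops _) n x ->
  ideal_power (@Gr_ops _) n (fglift (fun g => << gr_comp g f >> : Z[gr_hom k m]) x).
Proof.
apply: ideal_power_fglift => [p theta|p theta /Gr_pprod htheta].
  exact: As_Gr.
rewrite (_ : (fun _ => _) = fun x => \prod_(j < k) gr_delta j
    (fg_lift (fun i => gr_eval i (theta x)) (f (fg_gen j))))%g.
  apply: pprod_prod => j; apply: pprod_hom; apply: pprod_fg_lift => i.
  exact: pprod_hom.
apply/funext => z; rewrite [LHS]gr_deltaE; apply: eq_bigr => j _ /=.
by rewrite [theta z _]fg_homE.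
Qed.

Definition PnGr_gr (n : nat) : preadditive :=
  @linearized n (fun k l => gr_hom k l : monoidType) gr_id gr_comp
    gr_comp1m gr_compm1 gr_compA gr_comp1l gr_comp1r
    (fun k l => @Gr_ops (gr_hom k l))
    (@gr_power_compl n.+1) (@gr_power_compr n.+1).

Lemma p_Gr_comp n k l m (g : gr_hom l m) (f : gr_hom k l) :
  pn n (@Gr_ops _) (gr_comp g f) =
  pcomp (pn n (@Gr_ops _) g : @phom (PnGr_gr n) l m) (pn n (@Gr_ops _) f).
Proof.
exact: (@lcomp_pn n (fun k l => gr_hom k l : monoidType) gr_comp
  gr_comp1l gr_comp1r (fun k l => @Gr_ops (gr_hom k l))
  (@gr_power_compl n.+1) (@gr_power_compr n.+1)).
Qed.

Definition p_Gr (n : nat) : functor gr (PnGr_gr n) :=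
  @Functor gr (PnGr_gr n) id (fun k l => pn n (@Gr_ops (gr_hom k l)))
    (fun _ => erefl) (@p_Gr_comp n).

End PnGrGr.

(* Main.v *)
From HB Require Import structures.
From mathcomp Require Import all_boot all_algebra.
From mathcomp Require Import monoid boolp freeg.
Require Import Defs.

Set Implicit Arguments.
Unset Strict Implicit.
Unset Printing Implicit Defensive.

Import GRing.Theory.

Local Open Scope ring_scope.

(** The point is that I / I^{n+1} is a nilpotent ring, so that the circle
    operation F o G = F + G + F G makes it a group, and that x |-> x - 1 is
    multiplicative from the monoid to this group.  Passing to I / I^{n+1}
    therefore only sees homomorphisms to groups, and cannot distinguish a monoid
    from its groupification.

    In detail, let u : M -> N be a groupification, and P M = I(M) / I(M)^{n+1}.
    - By the existence half of the universal property, x |-> x - 1 from M to the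
      circle group of P M extends along u to a homomorphism psi on N.  The linear
      extension of psi to Z[N] carries a product of n+1 differences a - 1 to a
      product of n+1 elements of P M, which vanishes; hence it factors through
      P N and is a left inverse of P u.  So P u is injective
      (groupification_power_inj).
    - P u is itself a homomorphism of circle groups.  Both P u o psi and
      x |-> x - 1 are homomorphisms from N to the circle group of P N, and they
      agree on M; by the uniqueness half they are equal, so that every generator
      x - 1 of P N is in the image of P u (groupification_pn_surj).

    This applies to N = gr(k, l) because groupification commutes with finite
    powers (grp_hom_univ), and because on a group the ideals I^{n+1} defined by
    the associative words and by all group words agree: both are spanned by the
    products of at least n+1 differences a - 1 (ideal_powerE).  Functoriality of
    the map P u, and its compatibility with x |-> x - 1, are checked on
    generators. *)

(** * Powers of the augmentation ideal *)

Section DifferenceProducts.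
Variable M : monoidType.
Implicit Types (a : M) (s t : seq M) (x y z : Z[M]).

(** The monoid ring product is the bilinear composition of the category with a
    single object and endomorphism monoid M; hence the constant hom-sets and the
    dummy objects 0. *)
Definition zmul x y : Z[M] :=
  @zcomp (fun _ _ => M) (fun _ _ _ => @mul M) 0 0 0 x y.

Lemma zmulBl x x' y : zmul (x - x') y = zmul x y - zmul x' y.
Proof. exact: zcompBl. Qed.

Lemma zmulBr x y y' : zmul x (y - y') = zmul x y - zmul x y'.
Proof. exact: zcompBr. Qed.

Lemma zmul0l y : zmul 0 y = 0.
Proof. exact: zcomp0l. Qed.

Lemma zmul0r x : zmul x 0 = 0.
Proof. exact: zcomp0r. Qed.

Lemma zmulA x y z : zmul x (zmul y z) = zmul (zmul x y) z.
Proof. by apply: zcompA => *; exact: mulgA. Qed.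

Lemma zmulUl a y : zmul << a >> y = ztrans a y.
Proof. exact: zcompUl. Qed.

Lemma zmul1l y : zmul << 1%g >> y = y.
Proof. by apply: (@zcomp_id_l (fun _ _ => M) (fun=> 1%g)) => *; exact: mul1g. Qed.

Lemma ztrans_zmul a x y : ztrans a (zmul x y) = zmul (ztrans a x) y.
Proof. by rewrite -!zmulUl zmulA. Qed.

Lemma dprod_cat s t : dprod (s ++ t) = zmul (dprod s) (dprod t).
Proof.
by elim: s => [|a s IH] /=; rewrite ?zmul1l // zmulBl -ztrans_zmul IH.
Qed.

Lemma deg_dprod s : deg (dprod s) = (s == [::])%:Z.
Proof.
case: s => [|a s] /=; first by rewrite degU.
by rewrite raddfB /= -zmulUl [deg (zmul _ _)]deg_zcomp degU mul1r subrr.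
Qed.

(** The power I^k of the augmentation ideal, with I^0 = Z[M] (dspan0) and I^1 = I
    (dspan1), spanned by products of differences a - 1.  In this form it does not
    depend on a choice of operations, and its multiplicativity is concatenation
    of words. *)
Definition dspan k : Z[M] -> Prop :=
  zspan (fun z => exists2 s, (k <= size s)%N & z = dprod s).

Lemma dspan_dprod k s : (k <= size s)%N -> dspan k (dprod s).
Proof. by move=> ks; apply: zspan_gen; exists s. Qed.

Lemma dspan_zmul i j x y : dspan i x -> dspan j y -> dspan (i + j) (zmul x y).
Proof.
move=> hx hy; elim: hx => [|_ [s si ->]|x1 x2 _ IH1 _ IH2].
- by rewrite zmul0l; exact: zspan0.
- elim: hy => [|_ [t tj ->]|y1 y2 _ IH1 _ IH2].
  + by rewrite zmul0r; exact: zspan0.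
  + by rewrite -dprod_cat; apply: dspan_dprod; rewrite size_cat leq_add.
  + by rewrite zmulBr; exact: zspanB.
- by rewrite zmulBl; exact: zspanB.
Qed.

Lemma dspan_leq i j x : (i <= j)%N -> dspan j x -> dspan i x.
Proof.
move=> ij; elim=> [|_ [s sj ->]|y z _ hy _ hz].
- exact: zspan0.
- by apply: dspan_dprod; exact: leq_trans sj.
- exact: zspanB.
Qed.

Lemma dspan0 x : dspan 0 x.
Proof.
elim/Zind: x => [|x y hx hy|a]; [exact: zspan0 | exact: zspanB |].
have -> : << a >> = dprod [:: a] + dprod [::] :> Z[M].
  by rewrite /= subrK /ztrans fgliftU1 mulg1.
by apply: zspanD; exact: dspan_dprod.
Qed.

Lemma dspan1 x : deg x = 0 -> dspan 1 x.
Proof.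
move=> x0; suff: dspan 1 (x - << 1%g >> *~ deg x) by rewrite x0 mulr0z subr0.
elim/Zind: x {x0} => [|x y hx hy|a].
- by rewrite raddf0 mulr0z subr0; exact: zspan0.
- rewrite [deg _]raddfB /= mulrzBr.
  by have := zspanB hx hy; rewrite !opprB addrACA [- _ + _]addrC addrACA.
rewrite degU (_ : _ - _ = dprod [:: a]); first exact: dspan_dprod.
by rewrite /= /ztrans fgliftU1 mulg1.
Qed.

Section Power.
Variables (k : nat) (Theta : opset M).
Hypothesis As_Theta : forall m (theta : m.-tuple M -> M),
  As_ops theta -> Theta theta.
Hypothesis Theta_pprod : forall m (theta : m.-tuple M -> M),
  Theta theta -> pprod theta.

(** Expanding << theta x >> in products of differences leaves, after extension to
    arguments in the augmentation ideal, only the terms in which every argument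
    occurs; these have at least as many factors as theta has arguments. *)
Lemma ideal_powerE x : ideal_power Theta k x <-> dspan k x.
Proof.
split; elim=> [||y z _ hy _ hz]; try exact: zspan0; try exact: zspanB.
- move=> _ [m [theta [y [km /Theta_pprod/pprod_dsum hth yI ->]]]].
  rewrite /theta_bar; elim: hth => [ls as_ sz dep|F G _ hF _ hG]; last first.
    by rewrite mlext_add; exact: zspanD.
  have [/forallP all_ls|] := boolP [forall i : 'I_m, i \in ls].
    apply: zspan_mlext => x'; apply: dspan_dprod; rewrite sz (leq_trans km) //.
    rewrite -[X in (X <= _)%N]card_ord cardE.
    by apply: uniq_leq_size; rewrite ?enum_uniq.
  (* A term that omits the argument i dies, as y_i has augmentation 0. *)
  rewrite negb_forall => /existsP[i ils].
  rewrite (mlext_indep 1%g _ (yI i)); first exact: zspan0.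
  move=> u v uv; congr dprod; apply: dep => j jl; apply: uv.
  by apply: contraNneq ils => <-.
- by move=> _ [s ks ->]; exact: (@dprod_power M k Theta).
Qed.

End Power.

Lemma As_powerE k x : ideal_power (@As_ops M) k x <-> dspan k x.
Proof. by apply: ideal_powerE => // m theta; exact: As_pprod. Qed.

End DifferenceProducts.

(** * The circle group of the augmentation quotient *)

Section CircleGroup.
Variables (n : nat) (M : monoidType).
Local Notation P := (Pn n (@As_ops M)).
Implicit Types F G K : P.

(** The product induced by zmul, again as a composition in the category with a
    single object. *)
Definition pmul F G : P :=
  @lcomp n (fun _ _ => M) (fun _ _ _ => *%g) (fun _ _ => @As_ops M) 0 0 0 F G.

Lemma As_power_ltrans (g : M) (y : Z[M]) :
  ideal_power (@As_ops M) n.+1 y ->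
  ideal_power (@As_ops M) n.+1 (fglift (fun f => << (g * f)%g >> : Z[M]) y).
Proof.
rewrite -/(ztrans g y) -zmulUl => /As_powerE y_n; apply/As_powerE.
exact: (dspan_zmul (dspan0 _) y_n).
Qed.

Lemma As_power_rtrans (f : M) (x : Z[M]) :
  ideal_power (@As_ops M) n.+1 x ->
  ideal_power (@As_ops M) n.+1 (fglift (fun g => << (g * f)%g >> : Z[M]) x).
Proof.
move=> /As_powerE x_n; apply/As_powerE.
rewrite -[n.+1]addn0 (_ : fglift _ _ = zmul x << f >>).
  exact: dspan_zmul (dspan0 _).
exact/esym/zcompUr.
Qed.

Local Notation ltrans := (fun _ _ _ => @As_power_ltrans).
Local Notation rtrans := (fun _ _ _ => @As_power_rtrans).

Lemma pmulDl F F' G : pmul (F + F') G = pmul F G + pmul F' G.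
Proof. exact: (lcompDl ltrans rtrans). Qed.

Lemma pmulDr F G G' : pmul F (G + G') = pmul F G + pmul F G'.
Proof. exact: (lcompDr ltrans rtrans). Qed.

Lemma pmulA F G K : pmul F (pmul G K) = pmul (pmul F G) K.
Proof.
by apply: (lcompA _ ltrans rtrans) => *; exact: mulgA.
Qed.

Lemma pmul0l G : pmul 0 G = 0.
Proof. by apply: (addrI (pmul 0 G)); rewrite -pmulDl !addr0. Qed.

Lemma pmul0r F : pmul F 0 = 0.
Proof. by apply: (addrI (pmul F 0)); rewrite -pmulDr !addr0. Qed.

Lemma pmulBr F G G' : pmul F (G - G') = pmul F G - pmul F G'.
Proof. by apply: (addIr (pmul F G')); rewrite -pmulDr !subrK. Qed.

Lemma pmulNr F G : pmul F (- G) = - pmul F G.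
Proof. by rewrite -sub0r pmulBr pmul0r sub0r. Qed.

Lemma pn_pi0 : pn_pi 0 = 0 :> P.
Proof. by rewrite -(subrr (0 : aug_ideal M)) pn_piB subrr. Qed.

(** The factors in s and the last factor G, at least n + 1 in all, are represented
    in I, so that the product is represented in I^{n+1}. *)
Lemma pmul_nilpotent (s : seq P) G : (n <= size s)%N -> foldr pmul G s = 0.
Proof.
move=> ns; suff [z -> hz]: exists2 z : aug_ideal M,
    foldr pmul G s = pn_pi z & dspan (size s).+1 (aug_val z).
  rewrite -pn_pi0; apply/pn_pi_eq; rewrite subr0; apply/As_powerE.
  exact: dspan_leq hz.
elim: s {ns} => [|F s [z sE hz]] /=.
  exists (pn_repr G); first by rewrite pn_reprK.
  by apply: dspan1; apply/eqP; exact: aug_valP.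
rewrite sE -[F]pn_reprK [pmul _ _](lcomp_pi ltrans rtrans).
eexists; first by [].
rewrite -add1n; apply: dspan_zmul hz; apply: dspan1; apply/eqP; exact: aug_valP.
Qed.

(** (1 + F) (1 + G) = 1 + cmul F G. *)
Definition cmul F G : P := F + G + pmul F G.

(** The sum of (- F)^i for 1 <= i <= n, computed by iterating the equation
    G = - F - F G that says that G is a right inverse; the inverse of 1 + F is
    1 + cinv F. *)
Definition cinv F : P := iter n (fun G => - F - pmul F G) 0.

Lemma cmulA : associative cmul.
Proof.
move=> F G K; rewrite /cmul !pmulDr !pmulDl pmulA !addrA.
by rewrite [LHS](ACl (1*2*5*3*6*4*7))%AC.
Qed.

Lemma cmul0l : left_id 0 cmul.
Proof. by move=> F; rewrite /cmul pmul0l add0r addr0. Qed.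

Lemma cmul0r : right_id 0 cmul.
Proof. by move=> F; rewrite /cmul pmul0r !addr0. Qed.

Lemma cmulrV : right_inverse 0 cinv cmul.
Proof.
move=> F; rewrite /cmul /cinv; set step := fun G => _.
(* Consecutive iterates differ by a product with k + 1 factors, so the iteration
   is stationary from the n-th iterate on. *)
have stepB G G' : step G - step G' = - pmul F (G - G').
  by rewrite /step pmulBr opprB opprD !opprK addrACA addNr add0r addrC.
have step_diff k : exists G,
    iter k.+1 step 0 - iter k step 0 = foldr pmul G (nseq k F).
  elim: k => [|k [G IH]]; first by eexists.
  exists (- G); rewrite [LHS]stepB IH /=.
  suff -> : foldr pmul (- G) (nseq k F) = - foldr pmul G (nseq k F).
    by rewrite pmulNr.
  by elim: k {IH} => //= k ->; rewrite pmulNr.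
have [G] := step_diff n; rewrite pmul_nilpotent ?size_nseq //.
move=> /eqP; rewrite subr_eq0 /= {1}/step => /eqP; set y := iter _ _ _ => yE.
by rewrite -[X in F + X]yE /cmul addrA addrN sub0r addNr.
Qed.

(** In a monoid where every element has a right inverse, it is two-sided. *)
Lemma cmulV : left_inverse 0 cinv cmul.
Proof.
move=> F; rewrite -[X in cmul _ X]cmul0r -{1}(cmulrV (cinv F)).
by rewrite [cmul F _]cmulA cmulrV cmul0l cmulrV.
Qed.

(** The group structure is put on a synonym, since Pn is an additive group. *)
Definition circle : Type := P.
HB.instance Definition _ := Choice.copy circle P.
HB.instance Definition _ :=
  isGroup.Build circle cmulA cmul0l cmul0r cmulV cmulrV.

(** a b - 1 = (a - 1) + (b - 1) + (a - 1) (b - 1). *)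
Lemma pn_mul (a b : M) : pn n (@As_ops M) (a * b)%g =
  cmul (pn n (@As_ops M) a) (pn n (@As_ops M) b).
Proof.
rewrite /cmul [pmul _ _](lcomp_pi ltrans rtrans) -!pn_piD.
congr pn_pi; apply/val_inj => /=.
rewrite -/(zmul _ _) zmulBl !zmulBr !zmul1l !zmulUl.
rewrite /ztrans !fgliftU1 mulg1.
by rewrite [RHS]addrC [X in _ = _ + X]addrC addrA subrK addrA subrK.
Qed.

Lemma pn_one : pn n (@As_ops M) 1%g = 0 :> P.
Proof.
by rewrite -pn_pi0; congr pn_pi; apply/val_inj; rewrite /= subrr.
Qed.

Definition pn_circle (a : M) : circle := pn n (@As_ops M) a.

Lemma pn_circle_morph : monoid.monoid_morphism pn_circle.
Proof. by split=> [|a b]; [exact: pn_one | exact: pn_mul]. Qed.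

HB.instance Definition _ :=
  isUMagmaMorphism.Build M circle pn_circle pn_circle_morph.

End CircleGroup.

(** * Functoriality of the augmentation quotient *)

Section GroupRingMap.
Variables (N N' : choiceType) (u : N -> N').

Definition zmap (x : Z[N]) : Z[N'] := fglift (fun a => << u a >>) x.

Lemma zmapB x y : zmap (x - y) = zmap x - zmap y.
Proof. exact: fgliftB. Qed.

Lemma zmapU a : zmap << a >> = << u a >>.
Proof. exact: fgliftU1. Qed.

Lemma deg_zmap x : deg (zmap x) = deg x.
Proof.
elim/Zind: x => [|x y hx hy|a]; first by rewrite [zmap 0]fglift0 !raddf0.
  by rewrite zmapB !raddfB /= hx hy.
by rewrite zmapU !degU.
Qed.

Lemma zmap_aug_subproof (x : aug_ideal N) : zmap x \in @aug_pred N'.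
Proof. by rewrite /aug_pred unfold_in deg_zmap; exact: aug_valP. Qed.

Definition aug_map (x : aug_ideal N) : aug_ideal N' :=
  AugIdeal (zmap_aug_subproof x).

Lemma aug_mapB : {morph aug_map : x y / x - y}.
Proof. by move=> x y; apply/val_inj; exact: zmapB. Qed.

Variables (n : nat) (Theta : opset N) (Theta' : opset N').

Definition pn_map (F : Pn n Theta) : Pn n Theta' := pn_pi (aug_map (pn_repr F)).

Hypothesis zmap_power : forall x,
  ideal_power Theta n.+1 x -> ideal_power Theta' n.+1 (zmap x).

Lemma pn_map_pi x : pn_map (pn_pi x) = pn_pi (aug_map x).
Proof.
apply/pn_pi_eq => /=; rewrite -zmapB; apply: zmap_power.
by apply/pn_pi_eq; exact: pn_reprK.
Qed.

Lemma pn_mapB : {morph pn_map : F G / F - G}.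
Proof.
move=> F G; rewrite -[F]pn_reprK -[G]pn_reprK -pn_piB !pn_map_pi -pn_piB.
by rewrite aug_mapB.
Qed.

Lemma pn_map0 : pn_map 0 = 0.
Proof. by rewrite -(subrr 0) pn_mapB subrr. Qed.

Lemma pn_mapD : {morph pn_map : F G / F + G}.
Proof.
by move=> F G; rewrite -[G in LHS]opprK -[- G]sub0r !pn_mapB pn_map0 sub0r opprK.
Qed.

Lemma pn_map_inj : (forall x, deg x = 0 ->
    ideal_power Theta' n.+1 (zmap x) -> ideal_power Theta n.+1 x) ->
  injective pn_map.
Proof.
move=> zmap_inj F G; rewrite -[F]pn_reprK -[G]pn_reprK !pn_map_pi.
move=> /pn_pi_eq; rewrite -zmapB => /zmap_inj h; apply/pn_pi_eq/h.
by apply/eqP; exact: (aug_valP (pn_repr F - pn_repr G)).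
Qed.

End GroupRingMap.

Lemma pn_map_pn (N N' : monoidType) (u : monoid_hom N N') n
    (Theta : opset N) (Theta' : opset N') :
  (forall x, ideal_power Theta n.+1 x -> ideal_power Theta' n.+1 (zmap u x)) ->
  forall a, pn_map u Theta' (pn n Theta a) = pn n Theta' (u a).
Proof.
move=> hu a; rewrite [LHS]pn_map_pi //; congr pn_pi; apply/val_inj.
by rewrite /= zmapB !zmapU gmulf1.
Qed.

(** Used twice: for functoriality of the induced map on linearized categories and,
    with a single object, for its multiplicativity. *)
Section MapComposition.
Variables (n : nat) (H H' : nat -> nat -> monoidType).
Variables (compH : forall a b c, H b c -> H a b -> H a c).
Variables (compH' : forall a b c, H' b c -> H' a b -> H' a c).
Variables (Theta : forall a b, opset (H a b)).
Variables (Theta' : forall a b, opset (H' a b)).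
Variable u : forall a b, H a b -> H' a b.
Local Notation power := (@ideal_power _ (@Theta _ _) n.+1).
Local Notation power' := (@ideal_power _ (@Theta' _ _) n.+1).
Hypothesis power_compl : forall a b c (g : H b c) (y : Z[H a b]),
  power y -> power (fglift (fun f => << compH g f >> : Z[H a c]) y).
Hypothesis power_compr : forall a b c (f : H a b) (x : Z[H b c]),
  power x -> power (fglift (fun g => << compH g f >> : Z[H a c]) x).
Hypothesis power'_compl : forall a b c (g : H' b c) (y : Z[H' a b]),
  power' y -> power' (fglift (fun f => << compH' g f >> : Z[H' a c]) y).
Hypothesis power'_compr : forall a b c (f : H' a b) (x : Z[H' b c]),
  power' x -> power' (fglift (fun g => << compH' g f >> : Z[H' a c]) x).
Hypothesis u_comp : forall a b c (g : H b c) (f : H a b),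
  u (compH g f) = compH' (u g) (u f).
Hypothesis u_power : forall a b (x : Z[H a b]),
  power x -> power' (zmap (@u a b) x).

Lemma zmap_zcomp a b c (x : Z[H b c]) (y : Z[H a b]) :
  zmap (@u a c) (zcomp compH x y) =
  zcomp compH' (zmap (@u b c) x) (zmap (@u a b) y).
Proof.
elim/Zind: x => [|x x' hx hx'|g].
- by rewrite zcomp0l [zmap _ 0]fglift0 [zmap _ 0]fglift0 zcomp0l.
- by rewrite zcompBl !zmapB zcompBl hx hx'.
elim/Zind: y => [|y y' hy hy'|f].
- by rewrite zcomp0r [zmap _ 0]fglift0 [zmap _ 0]fglift0 zcomp0r.
- by rewrite zcompBr !zmapB zcompBr hy hy'.
by rewrite zcompU !zmapU zcompU u_comp.
Qed.

Lemma pn_map_lcomp a b c (G : Pn n (@Theta b c)) (F : Pn n (@Theta a b)) :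
  pn_map (@u a c) (@Theta' a c) (lcomp compH G F) =
  lcomp compH' (pn_map (@u b c) (@Theta' b c) G)
               (pn_map (@u a b) (@Theta' a b) F).
Proof.
rewrite -[G]pn_reprK -[F]pn_reprK (lcomp_pi power_compl power_compr).
rewrite !pn_map_pi; try exact: u_power.
rewrite (lcomp_pi power'_compl power'_compr); congr pn_pi; apply/val_inj.
exact: zmap_zcomp.
Qed.

End MapComposition.

Section PnGenerators.
Variables (n : nat) (N : monoidType) (Theta : opset N).
Local Notation P := (Pn n Theta).

(** The class of x in I is the sum of c_a (a - 1) if x is the sum of c_a a, because
    the sum of the c_a is 0. *)
Lemma fglift_pn (x : aug_ideal N) :
  fglift (pn n Theta : N -> zmodule P) x = pn_pi x :> P.
Proof.
(* Both sides become additive in x once pn_pi is extended to Z[N] along the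
   projection onto I. *)
have proj_aug (z : Z[N]) : z - << 1%g >> *~ deg z \in @aug_pred N.
  by rewrite /aug_pred unfold_in raddfB raddfMz /= degU intz subrr.
pose proj z := AugIdeal (proj_aug z).
rewrite [X in _ = pn_pi X](_ : _ = proj x); last first.
  by apply/val_inj; rewrite /= (eqP (aug_valP x)) mulr0z subr0.
symmetry; move: (aug_val _) => z.
apply: (@fglift_ext _ (zmodule P) _ (fun z => pn_pi (proj z))) => [y y'|a].
  rewrite -[RHS]pn_piB; congr pn_pi; apply/val_inj; rewrite /= raddfB /=.
  by rewrite mulrzBr !opprB addrACA [RHS]addrACA [- _ + _]addrC.
by congr pn_pi; apply/val_inj; rewrite /= degU.
Qed.

Lemma pn_gen_ind (Q : P -> Prop) : Q 0 ->
  (forall F G, Q F -> Q G -> Q (F - G)) -> (forall a, Q (pn n Theta a)) ->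
  forall F, Q F.
Proof.
move=> Q0 QB Qpn F; rewrite -[F]pn_reprK -fglift_pn.
elim/Zind: (aug_val _) => [|x y hx hy|a].
- by rewrite fglift0.
- by rewrite fgliftB; exact: QB.
- by rewrite fgliftU1.
Qed.

End PnGenerators.

(** * Invariance under groupification *)

Definition is_groupification (M N : monoidType) (u : monoid_hom M N) :=
  forall (G : groupType) (h : monoid_hom M G),
    exists! hh : monoid_hom N G, forall a, hh (u a) = h a.

Section GroupificationInvariance.
Variables (n : nat) (M N : monoidType) (u : monoid_hom M N).
Hypothesis u_univ : is_groupification u.

Lemma As_power_zmap x : ideal_power (@As_ops M) n.+1 x ->
  ideal_power (@As_ops N) n.+1 (zmap u x).
Proof.
by apply: ideal_power_fglift => // m theta /As_pprod; exact: pprod_hom.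
Qed.

Section Lift.
Variable psi : monoid_hom N (circle n M).

Let Psi (z : Z[N]) : Pn n (@As_ops M) := fglift (psi : N -> zmodule (Pn n _)) z.

Let PsiB x y : Psi (x - y) = Psi x - Psi y.
Proof. exact: (@fgliftB _ (zmodule _)). Qed.

(* psi (a b) = psi a + psi b + psi a . psi b, extended linearly in b. *)
Let Psi_ztrans a z :
  Psi (ztrans a z) = psi a *~ deg z + Psi z + pmul (psi a) (Psi z).
Proof.
elim/Zind: z => [|x y hx hy|b].
- rewrite -zmulUl zmul0r raddf0 mulr0z /Psi [fglift _ _]fglift0.
  by rewrite add0r [pmul _ _]pmul0r addr0.
- rewrite ztransB !PsiB hx hy [deg (x - y)]raddfB /= mulrzBr.
  rewrite [pmul _ (_ - _)]pmulBr opprD addrACA; congr (_ + _).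
  by rewrite opprD addrACA.
- rewrite degU mulr1z /ztrans fgliftU1 /Psi [LHS]fgliftU1 [fglift _ _]fgliftU1.
  by rewrite gmulfM.
Qed.

(* The word is split at its last letter because Psi is multiplicative on the
   augmentation ideal only: Psi (a - 1) = psi a is the base case. *)
Let Psi_dprod s a :
  Psi (dprod (rcons s a)) = foldr (@pmul n M) (psi a) (map psi s).
Proof.
elim: s => [|b s IH] /=.
  rewrite PsiB Psi_ztrans addrAC addrK degU.
  by rewrite /Psi [fglift _ _]fgliftU1 gmulf1 [pmul _ _]pmul0r addr0.
rewrite PsiB Psi_ztrans addrAC addrK deg_dprod IH -size_eq0 size_rcons.
by rewrite add0r.
Qed.

(** Psi induces a map on the quotient by I(N)^{n+1}: a product of n + 1 differences
    goes to a product of n + 1 elements of a ring in which such products vanish. *)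
Lemma circle_hom_power z :
  ideal_power (@As_ops N) n.+1 z -> Psi z = 0.
Proof.
move=> /As_powerE; elim=> [|_ [s ns ->]|x y _ hx _ hy].
- by rewrite /Psi [fglift _ _]fglift0.
- case/lastP: s ns => // s a; rewrite size_rcons ltnS => ns.
  by rewrite Psi_dprod pmul_nilpotent ?size_map.
- by rewrite PsiB hx hy subrr.
Qed.

End Lift.

(** If psi extends pn from M to N, then Psi is a left inverse of the map induced by
    u. *)
Lemma groupification_power_inj x : deg x = 0 ->
  ideal_power (@As_ops N) n.+1 (zmap u x) -> ideal_power (@As_ops M) n.+1 x.
Proof.
move=> x0 ux; have [psi [psiE _]] := u_univ (@pn_circle n M).
have xI : x \in @aug_pred M by apply/eqP.
pose X := AugIdeal xI.
have : pn_pi X = pn_pi 0 :> Pn n (@As_ops M).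
  rewrite pn_pi0 -fglift_pn -(circle_hom_power psi ux).
  rewrite /zmap [RHS]fglift_morph; last exact: fgliftB.
  by congr (@fglift _ (zmodule _) _ _ _); apply/funext => a; rewrite fgliftU1 psiE.
by move/pn_pi_eq; rewrite /= subr0.
Qed.

Local Notation u_map := (pn_map u (@As_ops N) : Pn n (@As_ops M) -> _).

Definition circle_map : circle n M -> circle n N := u_map.

Lemma circle_map_morph : monoid.monoid_morphism circle_map.
Proof.
split=> [|F G]; first by rewrite [LHS]pn_map0 //; exact: As_power_zmap.
rewrite [LHS]pn_mapD; last exact: As_power_zmap.
rewrite pn_mapD; last exact: As_power_zmap.
congr (_ + _); rewrite /pmul.
apply: (@pn_map_lcomp n (fun _ _ => M) (fun _ _ => N) _ _ _ _ (fun _ _ => u)).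
- by move=> *; exact: As_power_ltrans.
- by move=> *; exact: As_power_rtrans.
- by move=> *; exact: As_power_ltrans.
- by move=> *; exact: As_power_rtrans.
- by move=> *; exact: gmulfM.
- by move=> *; exact: As_power_zmap.
Qed.

HB.instance Definition _ :=
  isUMagmaMorphism.Build _ _ circle_map circle_map_morph.

(** With psi as above, u_map \o psi and pn are homomorphisms from N to a group that
    agree on M, so they are equal. *)
Lemma groupification_pn_surj (G : Pn n (@As_ops N)) : exists F, u_map F = G.
Proof.
have [psi [psiE _]] := u_univ (@pn_circle n M).
have [rho [_ rho_uniq]] := u_univ (@pn_circle n N \o u).
elim/pn_gen_ind: G => [|G G' [F <-] [F' <-]|a].
- by exists 0; rewrite pn_map0 //; exact: As_power_zmap.
- by exists (F - F'); rewrite pn_mapB //; exact: As_power_zmap.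
exists (psi a); transitivity (rho a).
  rewrite (rho_uniq (circle_map \o psi)) // => b /=.
  by rewrite psiE; apply: pn_map_pn; exact: As_power_zmap.
by rewrite (rho_uniq (@pn_circle n N)).
Qed.

End GroupificationInvariance.

(** * Groupification of powers of the free monoid *)

Section GroupificationOfPowers.

Lemma commute_fg_lift (T : choiceType) (G : groupType) (f : T -> G) (x : G) w :
  (forall i, commute x (f i)) -> commute x (fg_lift f w).
Proof.
move=> xf; rewrite /fg_lift; apply: commute_prod => -[i b] _; rewrite /letter_val.
by case: b => /=; [apply: commuteV |]; exact: xf.
Qed.

Lemma commute_fg_lift2 (T T' : choiceType) (G : groupType) (f : T -> G)
    (f' : T' -> G) w w' :
  (forall i j, commute (f i) (f' j)) -> commute (fg_lift f w) (fg_lift f' w').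
Proof.
move=> ff'; apply: commute_fg_lift => j; apply: commute_sym.
by apply: commute_fg_lift => i; exact: commute_sym.
Qed.

(** The off-diagonal form of prodgM_commute: F i and F' i need not commute. *)
Lemma prodgM_uniq (G : monoidType) (I : eqType) (r : seq I) (F F' : I -> G) :
  uniq r -> (forall i j, i != j -> commute (F i) (F' j)) ->
  (\prod_(i <- r) (F i * F' i) =
   \prod_(i <- r) F i * \prod_(i <- r) F' i)%g.
Proof.
move=> + FF'; elim: r => [|i r IH] /=; first by rewrite !big_nil mulg1.
case/andP=> ir ur; rewrite !big_cons IH // -!mulgA; congr (_ * _)%g.
rewrite !mulgA; congr (_ * _)%g; apply: commute_sym.
rewrite !big_seq; apply: commute_sym; apply: commute_prod => j jr.
by apply/commute_sym/FF'; apply: contraNneq ir => <-.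
Qed.

Variables k l : nat.

Lemma mon_delta_commute (i j : 'I_k) (v w : free_monoid 'I_l) : i != j ->
  commute (mon_delta i v) (mon_delta j w).
Proof.
move=> ij; apply: mon_homP => m; rewrite !mon_mulE !mon_extE.
by case: eqP => [->|_]; rewrite ?(negPf ij) ?mulg1 ?mul1g.
Qed.

Lemma grp_hom_morph : monoid.monoid_morphism (@grp_hom k l).
Proof.
split=> [|f g]; apply: gr_homP => i.
  by rewrite gr_oneE gr_extE mon_oneE gmulf1.
by rewrite gr_mulE !gr_extE mon_mulE gmulfM.
Qed.

HB.instance Definition _ :=
  isUMagmaMorphism.Build (mon_hom k l) (gr_hom k l) (@grp_hom k l) grp_hom_morph.

Lemma grp_hom_delta (j : 'I_k) (i : 'I_l) :
  grp_hom (mon_delta j (fm_gen i)) = gr_delta j (fg_gen i).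
Proof.
apply: gr_homP => m; rewrite !gr_extE mon_extE.
by case: eqP => _; [exact: fm_liftE | exact: gmulf1].
Qed.

Section Extension.
Variables (G : groupType) (h : monoid_hom (mon_hom k l) G).

Definition gr_lift (f : gr_hom k l) : G :=
  (\prod_(j < k) fg_lift (fun i => h (mon_delta j (fm_gen i))) (f (fg_gen j)))%g.

Lemma gr_lift_morph : monoid.monoid_morphism gr_lift.
Proof.
split=> [|f g]; first by apply: big1 => j _; rewrite gr_oneE gmulf1.
rewrite /gr_lift -prodgM_uniq; last 2 first.
- exact: index_enum_uniq.
- move=> i j ij; apply: commute_fg_lift2 => a b; apply: gmulf_commute.
  exact: mon_delta_commute.
by apply: eq_bigr => j _; rewrite gr_mulE gmulfM.
Qed.

HB.instance Definition _ :=
  isUMagmaMorphism.Build (gr_hom k l) G gr_lift gr_lift_morph.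

Lemma gr_lift_grp_hom f : gr_lift (grp_hom f) = h f.
Proof.
rewrite [f in RHS]mon_deltaE gmulf_prod; apply: eq_bigr => j _.
rewrite gr_extE /grp_unit /fm_lift gmulf_prod.
rewrite -[RHS]/((h \o @mon_delta k l j) (f (fm_gen j))) [RHS]fm_homE.
by apply: eq_bigr => i _; exact: fg_liftE.
Qed.

End Extension.

(** The factors of the power are free monoids, on which h extends uniquely; as the
    factors commute with one another, so do the images of their extensions, and
    the extensions multiply to a homomorphism. *)
Lemma grp_hom_univ : is_groupification (@grp_hom k l).
Proof.
move=> G h; exists (gr_lift h); split=> [f|hh hhE]; first exact: gr_lift_grp_hom.
apply: monoid_homP => f; rewrite [f in RHS]gr_deltaE gmulf_prod.
apply: eq_bigr => j _.
rewrite -[RHS]/((hh \o @gr_delta k l j) (f (fg_gen j))) [RHS]fg_homE.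
congr (fg_lift _ _); apply/funext => i /=.
by rewrite -grp_hom_delta hhE.
Qed.

End GroupificationOfPowers.

(** * The isomorphism of preadditive categories *)

Lemma functor_eq (A B : category) (o : A -> B)
    (m m' : forall a b, hom a b -> hom (o a) (o b)) m1 m1' mM mM' :
  (forall a b f, m a b f = m' a b f) ->
  @Functor A B o m m1 mM = @Functor A B o m' m1' mM'.
Proof.
move=> mm'; have E : m = m'.
  apply/functional_extensionality_dep => a.
  by apply/functional_extensionality_dep => b; exact/funext/mm'.
case: _ / E m1' mM' => m1' mM'.
by rewrite (Prop_irrelevance m1 m1') (Prop_irrelevance mM mM').
Qed.

Section PnGroupification.
Variable n : nat.

Lemma As_Gr_power (G : groupType) k (x : Z[G]) :
  ideal_power (@Gr_ops G) k x <-> ideal_power (@As_ops G) k x.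
Proof.
rewrite As_powerE; apply: ideal_powerE => m theta; first exact: As_Gr.
exact: Gr_pprod.
Qed.

Definition Pn_grp_hom k l : @phom (PnAs_mon n) k l -> @phom (PnGr_gr n) k l :=
  pn_map (@grp_hom k l) (@Gr_ops (gr_hom k l)).

Lemma grp_hom_power k l x : ideal_power (@As_ops (mon_hom k l)) n.+1 x ->
  ideal_power (@Gr_ops (gr_hom k l)) n.+1 (zmap (@grp_hom k l) x).
Proof. by move=> hx; apply/As_Gr_power; exact: As_power_zmap. Qed.

Lemma Pn_grp_hom_pn k l (f : mon_hom k l) :
  Pn_grp_hom (pn n (@As_ops _) f) = pn n (@Gr_ops _) (grp_hom f).
Proof. by apply: pn_map_pn; exact: grp_hom_power. Qed.

Lemma Pn_grp_homD k l : {morph @Pn_grp_hom k l : F G / F + G}.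
Proof. by apply: pn_mapD; exact: grp_hom_power. Qed.

Lemma Pn_grp_hom1 k :
  Pn_grp_hom (pidm (k : pobj (PnAs_mon n))) = pidm (k : pobj (PnGr_gr n)).
Proof. by rewrite [LHS]Pn_grp_hom_pn grp_hom1. Qed.

Lemma Pn_grp_homM k l m (G : @phom (PnAs_mon n) l m)
    (F : @phom (PnAs_mon n) k l) :
  Pn_grp_hom (pcomp G F) = pcomp (Pn_grp_hom G) (Pn_grp_hom F).
Proof.
apply: (@pn_map_lcomp n (fun k l => mon_hom k l : monoidType)
  (fun k l => gr_hom k l : monoidType) mon_comp gr_comp _ _ grp_hom).
- exact: mon_power_compl.
- exact: mon_power_compr.
- exact: gr_power_compl.
- exact: gr_power_compr.
- exact: grp_homM.
- exact: grp_hom_power.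
Qed.

Lemma Pn_grp_hom_inj k l : injective (@Pn_grp_hom k l).
Proof.
apply: pn_map_inj; first exact: grp_hom_power.
move=> x x0 /As_Gr_power; apply: groupification_power_inj => //.
exact: grp_hom_univ.
Qed.

Lemma Pn_grp_hom_surj k l G : exists F, @Pn_grp_hom k l F = G.
Proof.
have [F FE] := groupification_pn_surj (@grp_hom_univ k l)
  (pn_pi (pn_repr G) : Pn n (@As_ops (gr_hom k l))).
exists F; rewrite -[F]pn_reprK -[G]pn_reprK.
rewrite [LHS]pn_map_pi; last exact: grp_hom_power.
apply/pn_pi_eq; apply/As_Gr_power/pn_pi_eq.
by rewrite -FE -[F in RHS]pn_reprK pn_map_pi //; exact: As_power_zmap.
Qed.

Definition Pn_groupification : additive_functor (PnAs_mon n) (PnGr_gr n) :=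
  @AdditiveFunctor (PnAs_mon n) (PnGr_gr n)
    (@Functor (PnAs_mon n) (PnGr_gr n) id Pn_grp_hom Pn_grp_hom1 Pn_grp_homM)
    Pn_grp_homD.

Definition Pn_grp_hom_inv k l (G : @phom (PnGr_gr n) k l) :
  @phom (PnAs_mon n) k l :=
  sval (cid (Pn_grp_hom_surj G)).

Lemma Pn_grp_hom_invK k l : cancel (@Pn_grp_hom_inv k l) (@Pn_grp_hom k l).
Proof. by move=> G; rewrite /Pn_grp_hom_inv; case: cid. Qed.

Lemma Pn_grp_homK k l : cancel (@Pn_grp_hom k l) (@Pn_grp_hom_inv k l).
Proof. by move=> F; apply: Pn_grp_hom_inj; exact: Pn_grp_hom_invK. Qed.

Lemma Pn_grp_hom_inv1 k :
  Pn_grp_hom_inv (pidm (k : pobj (PnGr_gr n))) = pidm (k : pobj (PnAs_mon n)).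
Proof. by rewrite -Pn_grp_hom1 Pn_grp_homK. Qed.

Lemma Pn_grp_hom_invM k l m (G : @phom (PnGr_gr n) l m)
    (F : @phom (PnGr_gr n) k l) :
  Pn_grp_hom_inv (pcomp G F) = pcomp (Pn_grp_hom_inv G) (Pn_grp_hom_inv F).
Proof. by apply: Pn_grp_hom_inj; rewrite Pn_grp_homM !Pn_grp_hom_invK. Qed.

Lemma Pn_grp_hom_invD k l : {morph @Pn_grp_hom_inv k l : F G / F + G}.
Proof.
by move=> F G; apply: Pn_grp_hom_inj; rewrite Pn_grp_homD !Pn_grp_hom_invK.
Qed.

Definition Pn_groupification_inv : additive_functor (PnGr_gr n) (PnAs_mon n) :=
  @AdditiveFunctor (PnGr_gr n) (PnAs_mon n)
    (@Functor (PnGr_gr n) (PnAs_mon n) id Pn_grp_hom_inv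
       Pn_grp_hom_inv1 Pn_grp_hom_invM)
    Pn_grp_hom_invD.

End PnGroupification.

Theorem theorem5p33 (n : nat) (hn : (1 <= n)%N) :
  exists Png : additive_functor (PnAs_mon n) (PnGr_gr n),
    is_preadditive_iso Png /\
    comp_functor Png (p_As n) = comp_functor (p_Gr n) groupification.
Proof.
exists (Pn_groupification n); split.
  exists (Pn_groupification_inv n); split; apply: functor_eq => k l.
    exact: Pn_grp_homK.
  exact: Pn_grp_hom_invK.
apply: functor_eq => k l f; exact: Pn_grp_hom_pn.
Qed.
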